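(* For $r\ge1$ let $\sigma_r:=\sqrt{\mathrm{Var}(\mu^{(r)})}>0$ and let $\widetilde\mu^{(r)}$ be the probability measure on $\mathbb{R}$ supported on $\{d/\sigma_r:d\in\mathbb{Z}\}$ with $\widetilde\mu^{(r)}(\{d/\sigma_r\})=\mu^{(r)}(d)$ for all $d\in\mathbb{Z}$. Then $\widetilde\mu^{(r)}$ converges in distribution to the standard normal law $\mathcal{N}(0,1)$ as $\rho(r)\to\infty$; that is, for every sequence of integers $r_n\ge1$ with $\rho(r_n)\to\infty$, $\widetilde\mu^{(r_n)}\to\mathcal{N}(0,1)$ in distribution.
   Context: Fix an integer $b\ge 2$. Every $n\in\mathbb{N}$ has a unique base-$b$ expansion $n=\sum_{k\ge0}n_kb^k$ with digits in $\{0,\dots,b-1\}$; $s(n):=\sum_k n_k$. For $r,n\in\mathbb{N}$ put $\Delta^{(r)}(n):=s(n+r)-s(n)$, and for $d\in\mathbb{Z}$, $\mu^{(r)}(d):=\lim_{N\to\infty}\frac1N|\{n<N:\Delta^{(r)}(n)=d\}|$; these limits exist and define a probability measure on $\mathbb{Z}$ with finite moments, and $\mathrm{Var}(\mu^{(r)})>0$ for $r\ge1$. Blocks: write the expansion of $r\ge1$ as the digit string $r_\ell\cdots r_0$ with $r_\ell\ne0$. A block is either a maximal run of consecutive $0$ digits, or a maximal run of consecutive digits equal to $b-1$, or (when $b\ge3$) a single digit with value in $\{1,\dots,b-2\}$. $\rho(r)$ is the number of blocks of $r$. *)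

(* Defs.v *)
From Stdlib Require Import Reals Lra Lia ZArith Arith List.
From Coquelicot Require Import Coquelicot.
Open Scope R_scope.

Definition digit (b n k : nat) : nat := ((n / b ^ k) mod b)%nat.

(* s(n): base-b digit sum. For b >= 2, b^k > n for k >= n, so positions
   0..n cover all digits. *)
Definition digsum (b n : nat) : nat :=
  fold_right Nat.add 0%nat (map (digit b n) (seq 0 (S n))).

Definition Delta (b r n : nat) : Z :=
  (Z.of_nat (digsum b (n + r)) - Z.of_nat (digsum b n))%Z.

Definition cnt (b r : nat) (d : Z) (N : nat) : nat :=
  length (filter (fun n => Z.eqb (Delta b r n) d) (seq 0 N)).

Definition mu (b r : nat) (d : Z) : R :=
  real (Lim_seq (fun N => INR (cnt b r d N) / INR N)).

Definition zsum (f : Z -> R) : R :=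
  Series (fun k => f (Z.of_nat k)) + Series (fun k => f (- Z.of_nat (S k))%Z).

Definition mean_mu (b r : nat) : R := zsum (fun d => IZR d * mu b r d).
Definition var_mu (b r : nat) : R :=
  zsum (fun d => (IZR d) ^ 2 * mu b r d) - (mean_mu b r) ^ 2.
Definition sigma (b r : nat) : R := sqrt (var_mu b r).

Definition cdf_tilde (b r : nat) (x : R) : R :=
  zsum (fun d => if Rle_dec (IZR d / sigma b r) x then mu b r d else 0).

Definition Phi (x : R) : R :=
  RInt_gen (fun t => / sqrt (2 * PI) * exp (- (t ^ 2) / 2))
           (Rbar_locally m_infty) (at_point x).

Definition dclass (b c : nat) : nat :=
  if Nat.eqb c 0 then 0%nat else if Nat.eqb c (b - 1) then 1%nat else 2%nat.

(* position k (0 <= k <= l, i.e. b^k <= r) starts a new block when reading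
   from r_0 upward: k = 0, or r_k is a single-digit block in {1..b-2},
   or r_k is in a different class from r_(k-1). *)
Definition block_start (b r k : nat) : bool :=
  Nat.leb (b ^ k) r &&
  (Nat.eqb k 0 || Nat.eqb (dclass b (digit b r k)) 2 ||
   negb (Nat.eqb (dclass b (digit b r k)) (dclass b (digit b r (k - 1))))).

Definition rho (b r : nat) : nat :=
  length (filter (block_start b r) (seq 0 (S r))).

(* convergence in distribution of a sequence of laws given by distribution
   functions F n to N(0,1): F n x -> Phi x at every x (Phi is continuous) *)
Definition conv_dist_std_normal (F : nat -> R -> R) : Prop :=
  forall x : R, is_lim_seq (fun n => F n x) (Phi x).

(* Main.v *)
Require Import Defs.
From Stdlib Require Import Reals Lra Lia ZArith Arith List.
From Coquelicot Require Import Coquelicot.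
Open Scope R_scope.

(** Reading the lowest digit [c] of [b * r + c] shows that [mu b (b * r + c)] is the mixture
    of [mu b r] shifted by [c], with weight [(b - c) / b], and of [mu b (S r)] shifted by
    [c - b], with weight [c / b]. Hence all means vanish, and the second moments [V] satisfy
    [V (b * r + c) = (b - c) / b * V r + c / b * V (S r) + c * (b - c)] with bounded
    increments [V (S r) - V r].

    Let [g t x] be the probability that [x + sqrt (t + e) Z <= a] for a standard normal [Z];
    it solves the heat equation. Replacing [E_r g (0, x + h Delta)] by [g (h^2 V r, x)] at
    both ends of the recursion, the terms of order [h] and [h^2] cancel, so a digit creates
    an error of order [h^3], and none at all if it is [0]. Since this error is propagated
    by the recursion that defines [V], it is [O(h^3 V r)], which is [O(h)] for
    [h = 1 / sigma]. Letting [e] tend to 0 turns [g] into an indicator function.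

    It remains to see that [V r] tends to infinity with the number of blocks. With
    [D r = V (S r) - V r], the quantity [V + D / 2 + D^2 / 4] grows by a multiple of
    [b^2 - D^2] at each digit, and [b^2 - D^2] is bounded below at each change of block. *)

(** * The distribution function Phi *)

Definition bell (t : R) : R := exp (- (t ^ 2) / 2).
Definition bell_int (x : R) : R := RInt bell 0 x.

Lemma continuous_bell (x : R) : continuous bell x.
Proof. apply (ex_derive_continuous bell). unfold bell. auto_derive. exact I. Qed.

Lemma ex_RInt_bell (u v : R) : ex_RInt bell u v.
Proof. apply (ex_RInt_continuous bell). intros; apply continuous_bell. Qed.

Lemma is_derive_bell_int (x : R) : is_derive bell_int x (bell x).
Proof.
  apply is_derive_RInt with 0.
  - apply filter_forall. intros y. apply (RInt_correct bell), ex_RInt_bell.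
  - apply continuous_bell.
Qed.

(* [polar_int x] is the integral of [exp (- (u^2 + v^2) / 2)] over the part of the quadrant
   outside the square [0, x]^2, after the substitution [v = t u]. *)
Definition polar (x t : R) : R := 2 * exp (- (x ^ 2 * (1 + t ^ 2)) / 2) / (1 + t ^ 2).
Definition polar_int (x : R) : R := RInt (polar x) 0 1.

Lemma ex_RInt_polar (x u v : R) : ex_RInt (polar x) u v.
Proof.
  apply (ex_RInt_continuous (polar x)). intros z _.
  apply (ex_derive_continuous (polar x)). unfold polar. auto_derive. nra.
Qed.

(** The form [x * t + 0] is the affine argument that [RInt_comp_lin] expects in the next step. *)
Lemma is_derive_polar (x t : R) :
  is_derive (fun u => polar u t) x (- (2 * bell x) * (x * bell (x * t + 0))).
Proof.
  unfold polar, bell. auto_derive. nra.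
  replace (- (x * (x * 1) * (1 + t * (t * 1))) * / 2)
    with (- x ^ 2 / 2 + - (x * t + 0) ^ 2 / 2) by field.
  rewrite exp_plus. field. nra.
Qed.

(** Differentiation under the integral sign, followed by the substitution [v = x * t]. The result is
    minus the derivative of [bell_int ^ 2]. *)
Lemma is_derive_polar_int (x : R) :
  is_derive polar_int x (- (2 * bell x) * bell_int x).
Proof.
  assert (Hd : forall u v, Derive (fun z => polar z v) u
                           = - (2 * bell u) * (u * bell (u * v + 0))).
  { intros u v. apply is_derive_unique, is_derive_polar. }
  replace (- (2 * bell x) * bell_int x)
    with (RInt (fun t => Derive (fun u => polar u t) x) 0 1).
  - apply is_derive_RInt_param.
    + apply filter_forall. intros y t _. eexists. apply is_derive_polar.
    + intros t _. eapply continuity_2d_pt_ext.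
      { intros u v. symmetry. apply Hd. }
      assert (Hc : forall z, continuity_pt bell z).
      { intros z. apply continuity_pt_filterlim, continuous_bell. }
      repeat first [ apply continuity_2d_pt_mult | apply continuity_2d_pt_opp
        | apply continuity_2d_pt_plus | apply continuity_2d_pt_const
        | apply continuity_2d_pt_id1 | apply continuity_2d_pt_id2
        | apply (continuity_1d_2d_pt_comp bell); [apply Hc|] ].
    + apply filter_forall. intros y. apply ex_RInt_polar.
  - rewrite (RInt_ext _ (fun t => scal (- (2 * bell x)) (scal x (bell (x * t + 0))))).
    2:{ intros t _. rewrite Hd. reflexivity. }
    etransitivity.
    { apply (RInt_scal (fun t => scal x (bell (x * t + 0))) 0 1 (- (2 * bell x))).
      apply (ex_RInt_comp_lin bell), ex_RInt_bell. }
    etransitivity.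
    { apply f_equal. apply (RInt_comp_lin bell x 0 0 1), ex_RInt_bell. }
    rewrite Rmult_0_r, Rmult_1_r, !Rplus_0_r. reflexivity.
Qed.

(** At [x = 0] the integrand is [2 / (1 + t ^ 2)], with primitive [2 * atan t]. *)
Lemma polar_int_0 : polar_int 0 = PI / 2.
Proof.
  unfold polar_int.
  rewrite (RInt_ext _ (fun t => scal 2 (/ (1 + t ^ 2)))).
  2:{ intros t _. unfold polar, scal; simpl; unfold mult; simpl.
      replace (- (0 * (0 * 1) * (1 + t * (t * 1))) / 2) with 0 by field.
      rewrite exp_0. field. nra. }
  assert (H : is_RInt (fun t => / (1 + t ^ 2)) 0 1 (minus (atan 1) (atan 0))).
  { apply (is_RInt_derive atan).
    - intros t _. replace (t ^ 2) with (Rsqr t) by (unfold Rsqr; ring).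
      apply is_derive_atan.
    - intros t _. apply (ex_derive_continuous (fun t => / (1 + t ^ 2))). auto_derive. nra. }
  etransitivity.
  { apply (RInt_scal (fun t => / (1 + t ^ 2)) 0 1 2). eexists; exact H. }
  rewrite (is_RInt_unique _ _ _ _ H), atan_1, atan_0.
  unfold minus, plus, opp, scal; simpl; unfold mult; simpl. field.
Qed.

(** The derivatives of the two summands cancel, so the sum keeps its value at 0. This evaluates the
    Gaussian integral without a double integral. *)
Lemma bell_int_sqr (x : R) : bell_int x ^ 2 + polar_int x = PI / 2.
Proof.
  assert (H0 : bell_int 0 = 0) by exact (RInt_point 0 bell).
  assert (Hd : forall y, is_derive (fun u => bell_int u ^ 2 + polar_int u) y 0).
  { intros y. generalize (is_derive_bell_int y) (is_derive_polar_int y). intros H1 H2.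
    replace 0 with (plus (INR 2 * bell y * bell_int y ^ 1) (- (2 * bell y) * bell_int y))
      by (unfold plus; simpl; ring).
    apply (is_derive_plus (fun u => bell_int u ^ 2)); [|exact H2].
    apply (is_derive_pow bell_int 2), H1. }
  destruct (MVT_gen (fun u => bell_int u ^ 2 + polar_int u) 0 x (fun _ => 0)) as [c [_ Hc]].
  - intros y _. apply Hd.
  - intros y _. apply continuity_pt_filterlim.
    apply (ex_derive_continuous (fun u => bell_int u ^ 2 + polar_int u)).
    eexists. apply Hd.
  - rewrite H0, polar_int_0 in Hc. lra.
Qed.

Lemma polar_int_bounds (x : R) : 0 <= polar_int x <= 2 * bell x.
Proof.
  unfold polar_int. split.
  - apply RInt_ge_0; [lra|apply ex_RInt_polar|].
    intros t _. unfold polar. apply Rdiv_le_0_compat; [|nra].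
    generalize (exp_pos (- (x ^ 2 * (1 + t ^ 2)) / 2)); lra.
  - replace (2 * bell x) with (RInt (fun _ => 2 * bell x) 0 1).
    2:{ rewrite RInt_const. unfold scal; simpl; unfold mult; simpl. ring. }
    apply RInt_le; [lra|apply ex_RInt_polar|apply ex_RInt_const|].
    intros t _. unfold polar, bell.
    assert (exp (- (x ^ 2 * (1 + t ^ 2)) / 2) <= exp (- x ^ 2 / 2)).
    { assert (H : 0 <= x ^ 2 * t ^ 2) by (apply Rmult_le_pos; apply pow2_ge_0).
      destruct (Req_dec (x ^ 2 * t ^ 2) 0) as [H0|H0].
      - right. f_equal. lra.
      - left. apply exp_increasing. lra. }
    apply Rle_div_l; [nra|].
    assert (0 < exp (- x ^ 2 / 2)) by apply exp_pos. nra.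
Qed.

Lemma bell_int_nonneg (x : R) : 0 <= x -> 0 <= bell_int x.
Proof.
  intros Hx. apply RInt_ge_0; [exact Hx|apply ex_RInt_bell|].
  intros t _. apply Rlt_le, exp_pos.
Qed.

Lemma bell_int_opp (x : R) : bell_int (- x) = - bell_int x.
Proof.
  unfold bell_int.
  replace (- x) with (-1 * x + 0) by ring. replace 0 with (-1 * 0 + 0) at 1 by ring.
  etransitivity.
  { symmetry. apply (RInt_comp_lin bell (-1) 0 0 x), ex_RInt_bell. }
  rewrite (RInt_ext _ (fun t => opp (bell t))).
  - apply (RInt_opp bell), ex_RInt_bell.
  - intros t _. unfold bell, scal, opp; simpl; unfold mult; simpl.
    replace (- ((-1 * t + 0) * ((-1 * t + 0) * 1)) / 2) with (- (t * (t * 1)) / 2) by field.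
    ring.
Qed.

(** With [s] the claimed limit, [s * (s - bell_int x) <= s ^ 2 - bell_int x ^ 2 = polar_int x <= 2 *
    bell x], and [bell x <= 2 / x ^ 2] by [exp u >= 1 + u]. *)
Lemma is_lim_bell_int_p : is_lim bell_int p_infty (sqrt (PI / 2)).
Proof.
  apply is_lim_spec. intros eps. simpl.
  set (s := sqrt (PI / 2)).
  assert (Hpi := PI_RGT_0).
  assert (Hs : 0 < s) by (apply sqrt_lt_R0; lra).
  assert (Hs2 : s * s = PI / 2) by (apply sqrt_sqrt; lra).
  assert (He := cond_pos eps).
  (* Beyond this point both [1 < x] and [4 < s * eps * x], hence [4 < s * eps * x ^ 2]. *)
  exists (1 + 4 / (s * eps)). intros x Hx.
  assert (H4 : 0 < 4 / (s * eps)) by (apply Rdiv_lt_0_compat; nra).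
  assert (H4' : 4 / (s * eps) * (s * eps) = 4) by (field; split; lra).
  destruct (polar_int_bounds x) as [B0 B1].
  assert (HB := bell_int_sqr x). assert (H0 := bell_int_nonneg x ltac:(lra)).
  assert (Hb : bell x * x ^ 2 <= 2).
  { unfold bell. replace (- x ^ 2 / 2) with (- (x ^ 2 / 2)) by field.
    rewrite exp_Ropp. generalize (exp_ineq1_le (x ^ 2 / 2)); intros.
    assert (0 < x ^ 2) by nra.
    assert (0 < / exp (x ^ 2 / 2)) by (apply Rinv_0_lt_compat, exp_pos).
    assert (/ exp (x ^ 2 / 2) * exp (x ^ 2 / 2) = 1)
      by (apply Rinv_l, Rgt_not_eq, exp_pos). nra. }
  assert (Hbp : 0 < bell x) by apply exp_pos.
  assert (Hle : bell_int x <= s) by nra.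
  rewrite Rabs_left1 by lra.
  assert (K : s * (s - bell_int x) <= 2 * bell x) by nra.
  assert (Hx2 : 4 < s * eps * x ^ 2).
  { assert (4 < s * eps * x) by nra. assert (1 < x) by lra. nra. }
  assert (s * (s - bell_int x) * x ^ 2 <= 4) by nra.
  assert (0 < x ^ 2) by nra.
  assert (s * (s - bell_int x) * x ^ 2 < s * eps * x ^ 2) by lra.
  apply Rmult_lt_reg_r in H2; [|lra]. apply Rmult_lt_reg_l in H2; lra.
Qed.

Lemma sqrt_2PI_half : sqrt (2 * PI) = 2 * sqrt (PI / 2).
Proof.
  assert (Hpi := PI_RGT_0).
  replace (2 * PI) with (2 * 2 * (PI / 2)) by field.
  rewrite sqrt_mult, sqrt_square by lra. reflexivity.
Qed.

(** * Normalisation and regularity of [Phi] *)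

Definition gauss (t : R) : R := / sqrt (2 * PI) * exp (- (t ^ 2) / 2).
(** The odd primitive of the normal density: oddness transfers the limit at plus infinity to minus
    infinity. *)
Definition half_Phi (x : R) : R := / sqrt (2 * PI) * bell_int x.

Lemma is_derive_half_Phi (x : R) : is_derive half_Phi x (gauss x).
Proof. apply (is_derive_scal bell_int), is_derive_bell_int. Qed.

Lemma is_lim_half_Phi_p : is_lim half_Phi p_infty (1 / 2).
Proof.
  replace (Finite (1 / 2)) with (Rbar_mult (/ sqrt (2 * PI)) (sqrt (PI / 2))).
  - apply is_lim_scal_l, is_lim_bell_int_p.
  - simpl. rewrite sqrt_2PI_half. assert (0 < sqrt (PI / 2)).
    { apply sqrt_lt_R0. generalize PI_RGT_0; lra. }
    f_equal. field. lra.
Qed.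

Lemma half_Phi_opp (x : R) : half_Phi (- x) = - half_Phi x.
Proof. unfold half_Phi. rewrite bell_int_opp. ring. Qed.

Lemma is_lim_half_Phi_m : is_lim half_Phi m_infty (- (1 / 2)).
Proof.
  apply is_lim_ext with (fun x => - half_Phi (- x)).
  { intros x. rewrite half_Phi_opp. ring. }
  apply (is_lim_opp (fun x => half_Phi (- x)) m_infty (1 / 2)).
  apply (is_lim_comp half_Phi (fun x => - x) m_infty (1 / 2) p_infty).
  - apply is_lim_half_Phi_p.
  - apply (is_lim_opp (fun x => x) m_infty m_infty), is_lim_id.
  - exists 0. intros; discriminate.
Qed.

(** The improper integral is evaluated by the primitive [half_Phi], whose limit at minus infinity is
    [- (1 / 2)]. *)
Lemma Phi_half_Phi (x : R) : Phi x = 1 / 2 + half_Phi x.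
Proof.
  apply is_RInt_gen_unique.
  apply (is_RInt_gen_ext (Derive half_Phi)).
  { apply filter_forall. intros ab y _.
    apply is_derive_unique, is_derive_half_Phi. }
  replace (1 / 2 + half_Phi x) with (half_Phi x - - (1 / 2)) by ring.
  apply is_RInt_gen_Derive.
  - apply filter_forall. intros ab y _. eexists. apply is_derive_half_Phi.
  - apply filter_forall. intros ab y _.
    apply (continuous_ext gauss).
    { intros z. symmetry. apply is_derive_unique, is_derive_half_Phi. }
    apply (ex_derive_continuous gauss). unfold gauss. auto_derive. exact I.
  - apply is_lim_half_Phi_m.
  - intros P HP. unfold filtermap, at_point. apply locally_singleton, HP.
Qed.

Lemma is_derive_Phi (x : R) : is_derive Phi x (gauss x).
Proof.
  apply (is_derive_ext (fun y => plus (1 / 2) (half_Phi y))).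
  { intros y. rewrite Phi_half_Phi. reflexivity. }
  replace (gauss x) with (plus 0 (gauss x)) by (unfold plus; simpl; ring).
  apply (is_derive_plus (fun _ => 1 / 2)); [apply @is_derive_const|apply is_derive_half_Phi].
Qed.

Lemma is_lim_Phi_p : is_lim Phi p_infty 1.
Proof.
  apply is_lim_ext with (fun y => 1 / 2 + half_Phi y).
  { intros y. symmetry. apply Phi_half_Phi. }
  replace (Finite 1) with (Finite (1 / 2 + 1 / 2)) by (f_equal; field).
  apply is_lim_plus'; [apply is_lim_const|apply is_lim_half_Phi_p].
Qed.

Lemma is_lim_Phi_m : is_lim Phi m_infty 0.
Proof.
  apply is_lim_ext with (fun y => 1 / 2 + half_Phi y).
  { intros y. symmetry. apply Phi_half_Phi. }
  replace (Finite 0) with (Finite (1 / 2 + - (1 / 2))) by (f_equal; field).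
  apply is_lim_plus'; [apply is_lim_const|apply is_lim_half_Phi_m].
Qed.

Lemma gauss_pos (x : R) : 0 < gauss x.
Proof.
  apply Rmult_lt_0_compat; [|apply exp_pos].
  apply Rinv_0_lt_compat, sqrt_lt_R0. generalize PI_RGT_0; lra.
Qed.

Lemma Phi_incr (x y : R) : x <= y -> Phi x <= Phi y.
Proof.
  intros Hxy. destruct (MVT_gen Phi x y gauss) as [c [_ Hc]].
  - intros; apply is_derive_Phi.
  - intros z _. apply continuity_pt_filterlim.
    apply (ex_derive_continuous Phi). eexists. apply is_derive_Phi.
  - generalize (gauss_pos c). nra.
Qed.

Lemma Phi_bounds (x : R) : 0 <= Phi x <= 1.
Proof.
  split.
  - change (Rbar_le 0 (Phi x)).
    apply (is_lim_le_loc Phi (fun _ => Phi x) m_infty).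
    + exists x. intros y Hy. apply Phi_incr. lra.
    + apply is_lim_Phi_m.
    + apply is_lim_const.
  - change (Rbar_le (Phi x) 1).
    apply (is_lim_le_loc (fun _ => Phi x) Phi p_infty).
    + exists x. intros y Hy. apply Phi_incr. lra.
    + apply is_lim_const.
    + apply is_lim_Phi_p.
Qed.

(** * The digit recursion for mu *)

(** The cutoff [L] is separated from [n]: in [digsum] it is tied to the number itself, which changes
    when a digit is removed. *)
Definition low_digsum (b n L : nat) : nat :=
  fold_right Nat.add 0%nat (map (digit b n) (seq 0 L)).

Lemma digit_mul_add_0 (b n m : nat) : (m < b)%nat -> digit b (b * n + m) 0 = m.
Proof.
  intros Hm. unfold digit. rewrite Nat.pow_0_r, Nat.div_1_r, Nat.mul_comm, Nat.add_comm.
  rewrite Nat.Div0.mod_add. now apply Nat.mod_small.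
Qed.

Lemma digit_S (b n k : nat) : (b <> 0)%nat -> digit b n (S k) = digit b (n / b) k.
Proof.
  intros Hb. unfold digit. rewrite Nat.pow_succ_r', Nat.Div0.div_div. reflexivity.
Qed.

Lemma div_mul_add (b n m : nat) : (m < b)%nat -> ((b * n + m) / b)%nat = n.
Proof. intros Hm. symmetry. now apply Nat.div_unique with m. Qed.

Lemma low_digsum_S (b n L : nat) : (b <> 0)%nat ->
  low_digsum b n (S L) = (digit b n 0 + low_digsum b (n / b) L)%nat.
Proof.
  intros Hb. unfold low_digsum. simpl. f_equal.
  rewrite <- seq_shift, map_map. f_equal. apply map_ext. intros k. now apply digit_S.
Qed.

Lemma low_digsum_0 (b L : nat) : (2 <= b)%nat -> low_digsum b 0 L = 0%nat.
Proof.
  intros Hb. induction L as [|L IH]; [reflexivity|].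
  rewrite low_digsum_S, Nat.Div0.div_0_l, IH by lia.
  unfold digit. rewrite Nat.Div0.div_0_l, Nat.Div0.mod_0_l. reflexivity.
Qed.

(** Removing a digit strictly lowers a nonzero number, so both cutoffs can drop by one together
    until the number is 0. *)
Lemma low_digsum_stable (b : nat) : (2 <= b)%nat ->
  forall L L' n, (n < L)%nat -> (n < L')%nat -> low_digsum b n L = low_digsum b n L'.
Proof.
  intros Hb. induction L as [|L IH]; intros [|L'] n H H'; try lia.
  destruct (Nat.eq_dec n 0) as [->|Hn].
  - rewrite !low_digsum_0 by exact Hb. reflexivity.
  - rewrite !low_digsum_S by lia. f_equal.
    assert (n / b < n)%nat by (apply Nat.div_lt; lia). apply IH; lia.
Qed.

Lemma digsum_mul_add (b n m : nat) : (2 <= b)%nat -> (m < b)%nat ->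
  digsum b (b * n + m) = (digsum b n + m)%nat.
Proof.
  intros Hb Hm. change (low_digsum b (b * n + m) (S (b * n + m)) = low_digsum b n (S n) + m)%nat.
  rewrite low_digsum_S, digit_mul_add_0, div_mul_add by lia.
  rewrite Nat.add_comm. f_equal.
  destruct (Nat.eq_dec n 0) as [->|Hn].
  - rewrite !low_digsum_0 by exact Hb. reflexivity.
  - apply low_digsum_stable; nia.
Qed.

Lemma Delta_no_carry (b r c n m : nat) : (2 <= b)%nat -> (m + c < b)%nat ->
  Defs.Delta b (b * r + c) (b * n + m) = (Defs.Delta b r n + Z.of_nat c)%Z.
Proof.
  intros Hb H. unfold Defs.Delta.
  replace (b * n + m + (b * r + c))%nat with (b * (n + r) + (m + c))%nat by lia.
  rewrite !digsum_mul_add by lia. lia.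
Qed.

(** The carry replaces the low digit [m] by [m + c - b] and adds one more unit to the higher digits,
    so that [r] becomes [S r]. *)
Lemma Delta_carry (b r c n m : nat) : (2 <= b)%nat -> (m < b)%nat -> (c < b)%nat ->
  (b <= m + c)%nat ->
  Defs.Delta b (b * r + c) (b * n + m) = (Defs.Delta b (S r) n + Z.of_nat c - Z.of_nat b)%Z.
Proof.
  intros Hb Hm Hc H. unfold Defs.Delta.
  replace (b * n + m + (b * r + c))%nat with (b * (n + S r) + (m + c - b))%nat by lia.
  rewrite !digsum_mul_add by lia. lia.
Qed.

Lemma Delta_0 (b n : nat) : Defs.Delta b 0 n = 0%Z.
Proof. unfold Defs.Delta. rewrite Nat.add_0_r. lia. Qed.

(** A carry only lowers the digit sum, by [b - 1] each time, so adding 1 gains at most 1. This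
    anchors the existence of the densities for [r = 1]. *)
Lemma Delta_1_le (b : nat) : (2 <= b)%nat -> forall n, (Defs.Delta b 1 n <= 1)%Z.
Proof.
  intros Hb n. induction n as [n IH] using lt_wf_ind.
  rewrite (Nat.div_mod_eq n b).
  assert (Hm : (n mod b < b)%nat) by (apply Nat.mod_upper_bound; lia).
  replace 1%nat with (b * 0 + 1)%nat by lia.
  destruct (le_lt_dec b (n mod b + 1)) as [H|H].
  - rewrite Delta_carry by lia.
    assert (n / b < n)%nat.
    { apply Nat.div_lt; [|lia]. destruct (Nat.eq_dec n 0) as [->|]; [|lia].
      rewrite Nat.Div0.mod_0_l in H. lia. }
    specialize (IH _ H0). lia.
  - rewrite Delta_no_carry, Delta_0 by lia. lia.
Qed.

(** * Counting and existence of the densities *)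

Definition hit (b r : nat) (d : Z) (n : nat) : nat :=
  if Z.eqb (Defs.Delta b r n) d then 1%nat else 0%nat.

Lemma cnt_S (b r : nat) (d : Z) (N : nat) : cnt b r d (S N) = (cnt b r d N + hit b r d N)%nat.
Proof.
  unfold cnt, hit. rewrite seq_S, filter_app, length_app. simpl.
  destruct (Z.eqb (Defs.Delta b r N) d); reflexivity.
Qed.

Lemma cnt_add_le (b r : nat) (d : Z) (N j : nat) :
  (cnt b r d N <= cnt b r d (N + j) <= cnt b r d N + j)%nat.
Proof.
  induction j as [|j IH].
  - rewrite Nat.add_0_r. lia.
  - rewrite Nat.add_succ_r, cnt_S. unfold hit. destruct (Z.eqb _ _); lia.
Qed.

(** Of the residues below [j], those below [b - c] cause no carry and the others do; the truncated
    subtraction counts the latter. Partial periods are treated so that induction on [j] applies. *)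
Lemma cnt_mul_add (b r c : nat) (d : Z) (N j : nat) :
  (2 <= b)%nat -> (c < b)%nat -> (j <= b)%nat ->
  cnt b (b * r + c) d (b * N + j) =
  (cnt b (b * r + c) d (b * N)
   + Nat.min j (b - c) * hit b r (d - Z.of_nat c) N
   + (j - (b - c)) * hit b (S r) (d - Z.of_nat c + Z.of_nat b) N)%nat.
Proof.
  intros Hb Hc. induction j as [|j IH]; intros Hj.
  - rewrite Nat.add_0_r. simpl. lia.
  - rewrite Nat.add_succ_r, cnt_S, IH by lia.
    destruct (le_lt_dec b (j + c)) as [H|H].
    + replace (hit b (b * r + c) d (b * N + j))
        with (hit b (S r) (d - Z.of_nat c + Z.of_nat b) N).
      { rewrite !Nat.min_r by lia. nia. }
      unfold hit. rewrite Delta_carry by lia.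
      destruct (Z.eqb_spec (Defs.Delta b (S r) N) (d - Z.of_nat c + Z.of_nat b)),
        (Z.eqb_spec (Defs.Delta b (S r) N + Z.of_nat c - Z.of_nat b) d); lia.
    + replace (hit b (b * r + c) d (b * N + j)) with (hit b r (d - Z.of_nat c) N).
      { rewrite !Nat.min_l by lia. replace (S j - (b - c))%nat with 0%nat by lia.
        replace (j - (b - c))%nat with 0%nat by lia. lia. }
      unfold hit. rewrite Delta_no_carry by lia.
      destruct (Z.eqb_spec (Defs.Delta b r N) (d - Z.of_nat c)),
        (Z.eqb_spec (Defs.Delta b r N + Z.of_nat c) d); lia.
Qed.

Lemma cnt_mul (b r c : nat) (d : Z) (N : nat) : (2 <= b)%nat -> (c < b)%nat ->
  cnt b (b * r + c) d (b * N) =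
  ((b - c) * cnt b r (d - Z.of_nat c) N
   + c * cnt b (S r) (d - Z.of_nat c + Z.of_nat b) N)%nat.
Proof.
  intros Hb Hc. induction N as [|N IH].
  - rewrite Nat.mul_0_r. unfold cnt. simpl. lia.
  - replace (b * S N)%nat with (b * N + b)%nat by lia.
    rewrite cnt_mul_add, IH, !cnt_S, Nat.min_r by lia.
    replace (b - (b - c))%nat with c by lia. lia.
Qed.

(* Bounded discrepancy, not mere convergence: this is what the digit recursion preserves
   without any care for the values [N] that are not multiples of [b]. *)
Definition has_density (b r : nat) (d : Z) (m : R) : Prop :=
  exists C, forall N, Rabs (INR (cnt b r d N) - INR N * m) <= C.

Lemma has_density_mu (b r : nat) (d : Z) (m : R) : has_density b r d m -> mu b r d = m.
Proof.
  intros [C HC]. unfold mu.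
  assert (H : is_lim_seq (fun N => INR (cnt b r d N) / INR N) m).
  (* Passing to [S N] keeps the denominator away from 0; the quotient then errs by at most
     [C / (N + 1)]. *)
  { apply is_lim_seq_incr_1, is_lim_seq_spec. intros eps.
    assert (HI := is_lim_seq_INR). apply is_lim_seq_spec in HI.
    destruct (HI (C / eps)) as [N0 HN0]. exists N0. intros N HN.
    specialize (HC (S N)). specialize (HN0 (S N) ltac:(lia)).
    rewrite S_INR in *. assert (0 <= INR N) by apply pos_INR.
    replace (INR (cnt b r d (S N)) / (INR N + 1) - m)
      with ((INR (cnt b r d (S N)) - (INR N + 1) * m) / (INR N + 1)) by (field; lra).
    unfold Rdiv at 1. rewrite Rabs_mult, (Rabs_right (/ _)).
    2:{ apply Rle_ge, Rlt_le, Rinv_0_lt_compat. lra. }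
    apply Rlt_div_l; [lra|]. apply Rle_lt_trans with C; [exact HC|].
    assert (He := cond_pos eps). apply Rlt_div_l in HN0; lra. }
  apply is_lim_seq_unique in H. rewrite H. reflexivity.
Qed.

(** Counts up to multiples of [b] mix exactly by [cnt_mul], and the remaining fewer than [b] values
    cost a bounded amount. The guard [0 < c] reflects that without a carry [S r] does not occur,
    which lets the recursion pass through multiples of [b]. *)
Lemma has_density_mix (b r c : nat) (d : Z) (m1 m2 : R) : (2 <= b)%nat -> (c < b)%nat ->
  has_density b r (d - Z.of_nat c) m1 ->
  ((0 < c)%nat -> has_density b (S r) (d - Z.of_nat c + Z.of_nat b) m2) ->
  has_density b (b * r + c) d (INR (b - c) / INR b * m1 + INR c / INR b * m2).
Proof.
  intros Hb Hc [C1 H1] Hm2.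
  assert (H2 : exists C, forall N, INR c * Rabs (INR (cnt b (S r) (d - Z.of_nat c + Z.of_nat b) N)
                                                - INR N * m2) <= C).
  { destruct (Nat.eq_dec c 0) as [->|Hc0].
    - exists 0. intros N. simpl INR. lra.
    - destruct (Hm2 ltac:(lia)) as [C2 H2]. exists (INR c * C2). intros N.
      apply Rmult_le_compat_l; [apply pos_INR|apply H2]. }
  destruct H2 as [C2 H2].
  set (m := INR (b - c) / INR b * m1 + INR c / INR b * m2).
  assert (Hb0 : 0 < INR b) by (apply lt_0_INR; lia).
  (* The four terms bound the two weighted discrepancies, the change of the count over the remainder
     [j], and [j * m]. *)
  exists (INR (b - c) * C1 + C2 + INR b + INR b * Rabs m). intros N.
  rewrite (Nat.div_mod_eq N b). set (N' := (N / b)%nat). set (j := (N mod b)%nat).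
  assert (Hj : (j < b)%nat) by (apply Nat.mod_upper_bound; lia).
  destruct (cnt_add_le b (b * r + c) d (b * N') j) as [L1 L2].
  assert (E := cnt_mul b r c d N' Hb Hc).
  apply le_INR in L1, L2. rewrite plus_INR in L2.
  apply (f_equal INR) in E. rewrite plus_INR, !mult_INR in E.
  specialize (H1 N'). specialize (H2 N').
  apply lt_INR in Hj. assert (Hj0 := pos_INR j).
  assert (P1 := pos_INR (b - c)). assert (P2 := pos_INR c).
  rewrite plus_INR, mult_INR.
  replace (INR (cnt b (b * r + c) d (b * N' + j)) - (INR b * INR N' + INR j) * m)
    with ((INR (b - c) * (INR (cnt b r (d - Z.of_nat c) N') - INR N' * m1)
          + INR c * (INR (cnt b (S r) (d - Z.of_nat c + Z.of_nat b) N') - INR N' * m2))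
          + (INR (cnt b (b * r + c) d (b * N' + j)) - INR (cnt b (b * r + c) d (b * N')))
          + - (INR j * m)).
  2:{ rewrite E. unfold m. field. lra. }
  eapply Rle_trans; [apply Rabs_triang|]. apply Rplus_le_compat.
  - eapply Rle_trans; [apply Rabs_triang|]. apply Rplus_le_compat.
    + eapply Rle_trans; [apply Rabs_triang|].
      rewrite !Rabs_mult, (Rabs_right (INR (b - c))), (Rabs_right (INR c)) by lra.
      apply Rplus_le_compat; [apply Rmult_le_compat_l; assumption|exact H2].
    + rewrite Rabs_right; lra.
  - rewrite Rabs_Ropp, Rabs_mult, (Rabs_right (INR j)) by lra.
    apply Rmult_le_compat_r; [apply Rabs_pos|lra].
Qed.

Lemma has_density_0 (b : nat) (d : Z) : has_density b 0 d (if Z.eqb 0 d then 1 else 0).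
Proof.
  exists 0. intros N. induction N as [|N IH].
  - simpl. rewrite Rmult_0_l, Rminus_0_r, Rabs_R0. lra.
  - rewrite cnt_S, plus_INR, S_INR. unfold hit. rewrite Delta_0.
    destruct (Z.eqb 0 d); simpl INR; eapply Rle_trans; [|exact IH| |exact IH];
      right; f_equal; ring.
Qed.

Lemma has_density_1_above (b : nat) (d : Z) : (2 <= b)%nat -> (1 < d)%Z ->
  has_density b 1 d 0.
Proof.
  intros Hb Hd. exists 0. intros N.
  replace (cnt b 1 d N) with 0%nat.
  - simpl. rewrite Rmult_0_r, Rminus_0_r, Rabs_R0. lra.
  - induction N as [|N IH]; [reflexivity|]. rewrite cnt_S, <- IH. unfold hit.
    assert (H := Delta_1_le b Hb N).
    destruct (Z.eqb_spec (Defs.Delta b 1 N) d); [lia|reflexivity].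
Qed.

(* The recursion expresses the density at [d] through the one at [d + (b - 1)]. *)
Lemma density_1 (b : nat) : (2 <= b)%nat -> forall d, exists m, has_density b 1 d m.
Proof.
  intros Hb.
  assert (H : forall k d, (2 - Z.of_nat k <= d)%Z -> exists m, has_density b 1 d m).
  { induction k as [|k IH]; intros d Hd.
    - exists 0. apply has_density_1_above; [exact Hb|lia].
    - destruct (IH (d - Z.of_nat 1 + Z.of_nat b)%Z) as [m Hm]; [lia|].
      eexists. replace 1%nat with (b * 0 + 1)%nat by lia.
      apply has_density_mix; [exact Hb|lia|apply has_density_0|intros _; exact Hm]. }
  intros d. apply (H (Z.to_nat (2 - d))). lia.
Qed.

(** The quotient and its successor are both smaller than the number, with two exceptions handled by
    separate cases: [1 = b * 0 + 1] refers back to [S 0 = 1], and for [b = 2] the number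
    [2 = 2 * 1 + 0] would refer to [S 1]. *)
Lemma digit_ind (b : nat) (P : nat -> Prop) : (2 <= b)%nat -> P 0%nat -> P 1%nat ->
  (forall r, P r -> P (b * r)%nat) ->
  (forall r c, (0 < c < b)%nat -> P r -> P (S r) -> P (b * r + c)%nat) ->
  forall r, P r.
Proof.
  intros Hb P0 P1 Pmul Pmix r. induction r as [r IH] using lt_wf_ind.
  destruct (le_lt_dec r 1) as [H|H].
  - destruct r as [|[|r]]; [exact P0|exact P1|lia].
  - assert (Hc : (r mod b < b)%nat) by (apply Nat.mod_upper_bound; lia).
    assert (E := Nat.div_mod_eq r b). rewrite E.
    destruct (Nat.eq_dec (r mod b) 0) as [H0|H0].
    + rewrite H0, Nat.add_0_r in *. apply Pmul, IH. nia.
    + apply Pmix; [lia|apply IH; nia|].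
      destruct (Nat.eq_dec (r / b) 0) as [H1|H1]; [rewrite H1; exact P1|apply IH; nia].
Qed.

Lemma density (b : nat) : (2 <= b)%nat -> forall r d, has_density b r d (mu b r d).
Proof.
  intros Hb r.
  enough (H : forall d, exists m, has_density b r d m).
  { intros d. destruct (H d) as [m Hm]. rewrite (has_density_mu _ _ _ _ Hm). exact Hm. }
  revert r. apply (digit_ind b (fun r => forall d, exists m, has_density b r d m)); [exact Hb| | | |].
  - intros d. eexists. apply has_density_0.
  - apply density_1, Hb.
  - intros r H1 d. destruct (H1 (d - Z.of_nat 0)%Z) as [m1 D1].
    eexists. rewrite <- (Nat.add_0_r (b * r)).
    apply (has_density_mix b r 0 d m1 0); [exact Hb|lia|exact D1|lia].
  - intros r c Hc H1 H2 d.
    destruct (H1 (d - Z.of_nat c)%Z) as [m1 D1].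
    destruct (H2 (d - Z.of_nat c + Z.of_nat b)%Z) as [m2 D2].
    eexists. apply has_density_mix; [exact Hb|lia|exact D1|intros _; exact D2].
Qed.

Lemma mu_mix (b r c : nat) (d : Z) : (2 <= b)%nat -> (c < b)%nat ->
  mu b (b * r + c) d = INR (b - c) / INR b * mu b r (d - Z.of_nat c)
                       + INR c / INR b * mu b (S r) (d - Z.of_nat c + Z.of_nat b).
Proof.
  intros Hb Hc. apply has_density_mu, has_density_mix; try assumption; try intros _; now apply density.
Qed.

Lemma mu_mul (b r : nat) (d : Z) : (2 <= b)%nat -> mu b (b * r) d = mu b r d.
Proof.
  intros Hb. assert (H := mu_mix b r 0 d Hb ltac:(lia)).
  rewrite Nat.add_0_r, Nat.sub_0_r, Z.sub_0_r in H. rewrite H. simpl INR.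
  field. apply not_0_INR. lia.
Qed.

Lemma mu_0 (b : nat) (d : Z) : mu b 0 d = if Z.eqb 0 d then 1 else 0.
Proof. apply has_density_mu, has_density_0. Qed.

Lemma mu_1_above (b : nat) (d : Z) : (2 <= b)%nat -> (1 < d)%Z -> mu b 1 d = 0.
Proof. intros Hb Hd. apply has_density_mu, has_density_1_above; assumption. Qed.

(** Were the density negative, [- N * mu b r d] would outgrow the discrepancy bound [C] while the
    counts stay nonnegative. *)
Lemma mu_nonneg (b r : nat) (d : Z) : (2 <= b)%nat -> 0 <= mu b r d.
Proof.
  intros Hb. destruct (density b Hb r d) as [C HC].
  destruct (Rle_lt_dec 0 (mu b r d)) as [H|H]; [exact H|exfalso].
  assert (HI := is_lim_seq_INR). apply is_lim_seq_spec in HI.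
  destruct (HI (C / - mu b r d)) as [N HN]. specialize (HN N (le_n N)). specialize (HC N).
  apply Rlt_div_l in HN; [|lra]. apply Rabs_le_between in HC.
  assert (P := pos_INR (cnt b r d N)). lra.
Qed.

(** * Expectation with respect to mu *)

Definition zsummable (f : Z -> R) : Prop :=
  ex_series (fun k => f (Z.of_nat k)) /\ ex_series (fun k => f (- Z.of_nat (S k))%Z).

Lemma zsum_ext (f g : Z -> R) : (forall d, f d = g d) -> zsum f = zsum g.
Proof. intros H. unfold zsum. f_equal; apply Series_ext; intros; apply H. Qed.

Lemma zsummable_ext (f g : Z -> R) : (forall d, f d = g d) -> zsummable f -> zsummable g.
Proof.
  intros H [H1 H2].
  split; [apply (ex_series_ext _ _ (fun n => H _) H1)|apply (ex_series_ext _ _ (fun n => H _) H2)].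
Qed.

Lemma zsummable_plus (f g : Z -> R) : zsummable f -> zsummable g ->
  zsummable (fun d => f d + g d).
Proof. intros [F1 F2] [G1 G2]. split; now apply (ex_series_plus (V := R_NormedModule)). Qed.

Lemma zsum_plus (f g : Z -> R) : zsummable f -> zsummable g ->
  zsum (fun d => f d + g d) = zsum f + zsum g.
Proof.
  intros [F1 F2] [G1 G2]. unfold zsum.
  rewrite (Series_plus (fun k => f (Z.of_nat k)) (fun k => g (Z.of_nat k))) by assumption.
  rewrite (Series_plus (fun k => f (- Z.of_nat (S k))%Z) (fun k => g (- Z.of_nat (S k))%Z))
    by assumption.
  ring.
Qed.

Lemma zsummable_scal (a : R) (f : Z -> R) : zsummable f -> zsummable (fun d => a * f d).
Proof. intros [F1 F2]. split; now apply (ex_series_scal (V := R_NormedModule)). Qed.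

Lemma zsum_scal (a : R) (f : Z -> R) : zsum (fun d => a * f d) = a * zsum f.
Proof. unfold zsum. rewrite !Series_scal_l. ring. Qed.

Lemma is_series_zero (u : nat -> R) : (forall n, u n = 0) -> is_series u 0.
Proof.
  intros Hu. apply is_series_Reals. intros e He. exists 0%nat. intros n _.
  rewrite (sum_eq _ (fun _ => 0)) by (intros; apply Hu).
  rewrite sum_cte. unfold Rdist. rewrite Rmult_0_l, Rminus_0_r, Rabs_R0. exact He.
Qed.

Lemma zsum_le (f g : Z -> R) : zsummable f -> zsummable g -> (forall d, f d <= g d) ->
  zsum f <= zsum g.
Proof.
  intros Hf Hg H.
  assert (E : zsum g = zsum f + zsum (fun d => g d + -1 * f d)).
  { rewrite zsum_plus, zsum_scal by (try apply zsummable_scal; assumption). ring. }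
  assert (0 <= zsum (fun d => g d + -1 * f d)); [|lra].
  assert (K : forall u, (forall n, 0 <= u n) -> ex_series u -> 0 <= Series u).
  { intros u Hu Eu. replace 0 with (Series (fun _ : nat => 0)).
    - apply Series_le; [|exact Eu]. intros n. split; [lra|apply Hu].
    - now apply is_series_unique, is_series_zero. }
  destruct (zsummable_plus g (fun d => -1 * f d) Hg (zsummable_scal _ _ Hf)) as [E1 E2].
  apply Rplus_le_le_0_compat; apply K; try assumption; intros n; cbv beta;
    [specialize (H (Z.of_nat n))|specialize (H (- Z.of_nat (S n))%Z)]; lra.
Qed.

(** The term [f 0] moves from the nonnegative half of the sum to the negative half. *)
Lemma zsum_shift_1 (f : Z -> R) : zsummable f ->
  zsummable (fun d => f (d + 1)%Z) /\ zsum (fun d => f (d + 1)%Z) = zsum f.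
Proof.
  intros [F1 F2].
  assert (G1 : ex_series (fun k => f (Z.of_nat k + 1)%Z)).
  { apply ex_series_ext with (fun k => f (Z.of_nat (S k))).
    - intros n. f_equal. lia.
    - apply (ex_series_incr_1 (fun k => f (Z.of_nat k))), F1. }
  assert (G2 : ex_series (fun k => f (- Z.of_nat (S k) + 1)%Z)).
  { apply (ex_series_incr_1 (fun k => f (- Z.of_nat (S k) + 1)%Z)).
    apply ex_series_ext with (fun k => f (- Z.of_nat (S k))%Z).
    - intros n. f_equal. lia.
    - exact F2. }
  split; [split; assumption|]. unfold zsum.
  rewrite (Series_incr_1 (fun k => f (Z.of_nat k))) by exact F1.
  rewrite (Series_incr_1 (fun k => f (- Z.of_nat (S k) + 1)%Z)) by exact G2.
  rewrite (Series_ext (fun k => f (Z.of_nat k + 1)%Z) (fun k => f (Z.of_nat (S k))))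
    by (intros; f_equal; lia).
  rewrite (Series_ext (fun k => f (- Z.of_nat (S (S k)) + 1)%Z) (fun k => f (- Z.of_nat (S k))%Z))
    by (intros; f_equal; lia).
  simpl Z.of_nat. simpl Z.add. ring.
Qed.

Lemma zsum_shift_nat (c : nat) (f : Z -> R) : zsummable f ->
  zsum (fun d => f (d + Z.of_nat c)%Z) = zsum f.
Proof.
  revert f. induction c as [|c IH]; intros f Hf.
  - apply zsum_ext. intros d. f_equal. lia.
  - destruct (zsum_shift_1 f Hf) as [S1 E1]. rewrite <- E1, <- (IH _ S1).
    apply zsum_ext. intros d. f_equal. lia.
Qed.

(** A negative shift is a positive one read backwards, starting from the shifted function. *)
Lemma zsum_shift (c : Z) (f : Z -> R) : zsummable f -> zsummable (fun d => f (d + c)%Z) ->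
  zsum (fun d => f (d + c)%Z) = zsum f.
Proof.
  intros Hf Hg. destruct (Z_le_dec 0 c) as [Hc|Hc].
  - rewrite <- (zsum_shift_nat (Z.to_nat c) f Hf). apply zsum_ext. intros d. f_equal. lia.
  - rewrite <- (zsum_shift_nat (Z.to_nat (- c)) _ Hg). apply zsum_ext. intros d. f_equal. lia.
Qed.

(** The triangle inequality [|d| <= |d + c| + |c|] in the exponent. *)
Lemma pow_Zabs_shift (q : R) (d c : Z) : 0 < q <= 1 ->
  q ^ Z.abs_nat (d + c) <= / q ^ Z.abs_nat c * q ^ Z.abs_nat d.
Proof.
  intros Hq.
  assert (H : (Z.abs_nat d <= Z.abs_nat (d + c) + Z.abs_nat c)%nat) by lia.
  assert (P : 0 < q ^ Z.abs_nat c) by (apply pow_lt; lra).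
  assert (L : forall m n, (m <= n)%nat -> q ^ n <= q ^ m).
  { intros m n Hmn. replace n with (m + (n - m))%nat by lia. rewrite pow_add.
    assert (0 < q ^ m) by (apply pow_lt; lra).
    assert (q ^ (n - m) <= 1 ^ (n - m)) by (apply pow_incr; lra).
    rewrite pow1 in *. nra. }
  apply Rmult_le_reg_l with (q ^ Z.abs_nat c); [exact P|].
  rewrite <- Rmult_assoc, Rinv_r, Rmult_1_l, <- pow_add by lra.
  apply L. lia.
Qed.

(** * Exponential decay against quadratic growth *)

Definition decays (q : R) (f : Z -> R) : Prop :=
  exists K, forall d, Rabs (f d) <= K * q ^ Z.abs_nat d.

(** Quadratic growth admits second moments and bounded test functions, and is stable under
    shifts. *)
Definition tempered (F : Z -> R) : Prop :=
  exists K, forall d, Rabs (F d) <= K * (1 + IZR d ^ 2).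

Lemma decays_nonneg_const (q : R) (f : Z -> R) : decays q f ->
  exists K, 0 <= K /\ forall d, Rabs (f d) <= K * q ^ Z.abs_nat d.
Proof.
  intros [K HK]. exists K. split; [|exact HK].
  specialize (HK 0%Z). simpl in HK. generalize (Rabs_pos (f 0%Z)); lra.
Qed.

Lemma tempered_nonneg_const (F : Z -> R) : tempered F ->
  exists K, 0 <= K /\ forall d, Rabs (F d) <= K * (1 + IZR d ^ 2).
Proof.
  intros [K HK]. exists K. split; [|exact HK].
  specialize (HK 0%Z). simpl in HK. generalize (Rabs_pos (F 0%Z)); lra.
Qed.

Lemma tempered_shift (c : Z) (F : Z -> R) : tempered F -> tempered (fun d => F (d + c)%Z).
Proof.
  intros HF. destruct (tempered_nonneg_const F HF) as [K [K0 HK]].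
  exists (K * (2 * (1 + IZR c ^ 2))). intros d. eapply Rle_trans; [apply HK|].
  rewrite Rmult_assoc. apply Rmult_le_compat_l; [exact K0|].
  rewrite plus_IZR. assert (0 <= (IZR d - IZR c) ^ 2) by apply pow2_ge_0.
  assert (0 <= IZR c ^ 2 * IZR d ^ 2) by (apply Rmult_le_pos; apply pow2_ge_0). nra.
Qed.

Lemma tempered_bounded (F : Z -> R) (K : R) : (forall d, Rabs (F d) <= K) -> tempered F.
Proof.
  intros H. exists K. intros d. specialize (H d).
  assert (0 <= K) by (generalize (Rabs_pos (F d)); lra).
  assert (0 <= IZR d ^ 2) by apply pow2_ge_0. nra.
Qed.

Lemma decays_shift (q : R) (c : Z) (f : Z -> R) : 0 < q <= 1 -> decays q f ->
  decays q (fun d => f (d + c)%Z).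
Proof.
  intros Hq Hf. destruct (decays_nonneg_const q f Hf) as [K [K0 HK]].
  exists (K * / q ^ Z.abs_nat c). intros d. eapply Rle_trans; [apply HK|].
  rewrite Rmult_assoc. apply Rmult_le_compat_l; [exact K0|]. now apply pow_Zabs_shift.
Qed.

Lemma decays_plus_scal (q a1 a2 : R) (f g : Z -> R) : decays q f -> decays q g ->
  decays q (fun d => a1 * f d + a2 * g d).
Proof.
  intros [K1 H1] [K2 H2]. exists (Rabs a1 * K1 + Rabs a2 * K2). intros d.
  eapply Rle_trans; [apply Rabs_triang|]. rewrite !Rabs_mult, Rmult_plus_distr_r, !Rmult_assoc.
  apply Rplus_le_compat; apply Rmult_le_compat_l; auto using Rabs_pos.
Qed.

(** Two square roots split [q ^ k]: with [w] the fourth root, [k * w ^ k] is bounded, hence so is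
    [k ^ 2 * v ^ k] for [v = w ^ 2], and a factor [v ^ k] remains to sum. *)
Lemma ex_series_quadratic_geom (q : R) : 0 < q < 1 ->
  ex_series (fun k => (1 + INR k ^ 2) * q ^ k).
Proof.
  intros Hq. set (v := sqrt q). set (w := sqrt v).
  assert (Hv : 0 < v) by (apply sqrt_lt_R0; lra).
  assert (Hvv : v * v = q) by (apply sqrt_sqrt; lra).
  assert (Hw : 0 < w) by (apply sqrt_lt_R0; lra).
  assert (Hww : w * w = v) by (apply sqrt_sqrt; lra).
  assert (Hv1 : v < 1) by nra. assert (Hw1 : w < 1) by nra.
  set (a := / w - 1).
  assert (Ha : 0 < a).
  { unfold a. assert (1 < / w); [|lra]. rewrite <- Rinv_1. apply Rinv_lt_contravar; lra. }
  assert (Hk : forall k, w ^ k * INR k <= / a).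
  { intros k. assert (B := poly k a Ha).
    replace (1 + a) with (/ w) in B by (unfold a; ring). rewrite pow_inv in B.
    assert (0 < w ^ k) by (apply pow_lt; lra).
    assert (w ^ k * (1 + INR k * a) <= 1).
    { apply Rmult_le_compat_l with (r := w ^ k) in B; [|lra]. rewrite Rinv_r in B; lra. }
    apply Rmult_le_reg_r with a; [exact Ha|]. rewrite Rinv_l by lra. nra. }
  apply @ex_series_le with (fun k => (1 + / a * / a) * v ^ k).
  - intros k. change (Rabs ((1 + INR k ^ 2) * q ^ k) <= (1 + / a * / a) * v ^ k).
    assert (0 < v ^ k) by (apply pow_lt; lra).
    assert (v ^ k <= 1) by (rewrite <- (pow1 k); apply pow_incr; lra).
    rewrite Rabs_right.
    2:{ apply Rle_ge, Rmult_le_pos; [generalize (pow2_ge_0 (INR k)); lra|].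
        apply pow_le; lra. }
    replace (q ^ k) with (v ^ k * v ^ k) by (rewrite <- Rpow_mult_distr, Hvv; reflexivity).
    assert (Hwk : w ^ k * w ^ k = v ^ k) by (rewrite <- Rpow_mult_distr, Hww; reflexivity).
    assert (v ^ k * INR k ^ 2 <= / a * / a).
    { rewrite <- Hwk. specialize (Hk k).
      assert (0 <= w ^ k * INR k) by (apply Rmult_le_pos; [apply pow_le; lra|apply pos_INR]).
      replace (w ^ k * w ^ k * INR k ^ 2) with ((w ^ k * INR k) * (w ^ k * INR k)) by ring.
      apply Rmult_le_compat; assumption. }
    replace ((1 + INR k ^ 2) * (v ^ k * v ^ k))
      with ((v ^ k + v ^ k * INR k ^ 2) * v ^ k) by ring.
    apply Rmult_le_compat_r; lra.
  - apply (ex_series_scal (V := R_NormedModule)), ex_series_geom.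
    rewrite Rabs_right; lra.
Qed.

Lemma zsummable_tempered_decays (q : R) (F f : Z -> R) : 0 < q < 1 ->
  tempered F -> decays q f -> zsummable (fun d => F d * f d).
Proof.
  intros Hq HF Hf.
  destruct (tempered_nonneg_const F HF) as [K1 [P1 H1]].
  destruct (decays_nonneg_const q f Hf) as [K2 [P2 H2]].
  assert (H : forall d, Rabs (F d * f d)
                        <= K1 * K2 * ((1 + INR (Z.abs_nat d) ^ 2) * q ^ Z.abs_nat d)).
  { intros d. rewrite Rabs_mult.
    replace (INR (Z.abs_nat d) ^ 2) with (IZR d ^ 2).
    - replace (K1 * K2 * ((1 + IZR d ^ 2) * q ^ Z.abs_nat d))
        with (K1 * (1 + IZR d ^ 2) * (K2 * q ^ Z.abs_nat d)) by ring.
      apply Rmult_le_compat; auto using Rabs_pos.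
    - rewrite INR_IZR_INZ, Zabs2Nat.id_abs, abs_IZR, RPow_abs, Rabs_right; [reflexivity|].
      apply Rle_ge, pow2_ge_0. }
  assert (E : ex_series (fun k => K1 * K2 * ((1 + INR k ^ 2) * q ^ k))).
  { apply (ex_series_scal (V := R_NormedModule)), ex_series_quadratic_geom, Hq. }
  split.
  - eapply (ex_series_le (V := R_CompleteNormedModule)); [|exact E].
    intros k. specialize (H (Z.of_nat k)). rewrite Zabs2Nat.id in H. exact H.
  - eapply (ex_series_le (V := R_CompleteNormedModule)); [|exact (proj1 (ex_series_incr_1 _) E)].
    intros k. specialize (H (- Z.of_nat (S k))%Z).
    replace (Z.abs_nat (- Z.of_nat (S k))) with (S k) in H by lia. exact H.
Qed.

(** A decay rate adapted to carries: one carry has weight [1 / b] and lowers the digit sum by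
    [b - 1], and [1 / b <= ratio b ^ (b - 1)]. *)
Definition ratio (b : nat) : R := INR (b - 1) / INR b.

Lemma ratio_bounds (b : nat) : (2 <= b)%nat -> 0 < ratio b < 1.
Proof.
  intros Hb. assert (1 <= INR (b - 1)) by (apply (le_INR 1); lia).
  unfold ratio. rewrite minus_INR in * by lia. simpl INR in *. split.
  - apply Rdiv_lt_0_compat; lra.
  - apply Rlt_div_l; lra.
Qed.

(** Bernoulli's inequality [(1 - 1 / b) ^ k >= 1 - k / b] at [k = b - 1]. *)
Lemma inv_le_ratio_pow (b : nat) : (2 <= b)%nat -> / INR b <= ratio b ^ (b - 1).
Proof.
  intros Hb. assert (Hb0 : 0 < INR b) by (apply lt_0_INR; lia).
  assert (B : forall k, 1 - INR k / INR b <= ratio b ^ k).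
  { induction k as [|k IH].
    - simpl. unfold Rdiv. lra.
    - destruct (ratio_bounds b Hb) as [Q0 Q1].
      assert (0 <= ratio b ^ k <= 1).
      { split; [apply pow_le; lra|]. rewrite <- (pow1 k). apply pow_incr. lra. }
      replace (ratio b ^ S k) with (ratio b ^ k - ratio b ^ k / INR b).
      2:{ simpl. unfold ratio at 3. rewrite minus_INR by lia. simpl. field. lra. }
      rewrite S_INR. assert (ratio b ^ k / INR b <= 1 / INR b).
      { apply Rmult_le_compat_r; [|lra]. apply Rlt_le, Rinv_0_lt_compat, Hb0. }
      unfold Rdiv in *. lra. }
  specialize (B (b - 1)%nat). rewrite minus_INR in B by lia. simpl INR in B.
  replace (1 - (INR b - 1) / INR b) with (/ INR b) in B by (field; lra). exact B.
Qed.

Lemma mu_1_mix (b : nat) (d : Z) : (2 <= b)%nat ->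
  mu b 1 d = ratio b * mu b 0 (d - 1) + / INR b * mu b 1 (d - 1 + Z.of_nat b).
Proof.
  intros Hb. assert (H := mu_mix b 0 1 d Hb ltac:(lia)).
  replace (b * 0 + 1)%nat with 1%nat in H by lia. rewrite H. unfold ratio. simpl INR.
  simpl Z.of_nat. unfold Rdiv. ring.
Qed.

(** [mu b 1] is a geometric law on the points [1 - j * (b - 1)]. The recursion lowers [k] by [b - 1]
    at the price [1 / b], which [inv_le_ratio_pow] absorbs. *)
Lemma mu_1_le (b k : nat) : (2 <= b)%nat -> mu b 1 (1 - Z.of_nat k) <= ratio b ^ k.
Proof.
  intros Hb. destruct (ratio_bounds b Hb) as [Q0 Q1].
  assert (Hb0 : 0 < / INR b) by (apply Rinv_0_lt_compat, lt_0_INR; lia).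
  induction k as [k IH] using lt_wf_ind.
  rewrite mu_1_mix, mu_0 by exact Hb.
  destruct (Z.eqb_spec 0 (1 - Z.of_nat k - 1)) as [E|E].
  - rewrite mu_1_above by lia. replace k with 0%nat by lia. simpl. lra.
  - destruct (le_lt_dec (b - 1) k) as [H|H].
    + replace (1 - Z.of_nat k - 1 + Z.of_nat b)%Z with (1 - Z.of_nat (k - (b - 1)))%Z by lia.
      specialize (IH (k - (b - 1))%nat ltac:(lia)).
      replace k with ((b - 1) + (k - (b - 1)))%nat at 2 by lia. rewrite pow_add, Rmult_0_r, Rplus_0_l.
      apply Rmult_le_compat; [lra|now apply mu_nonneg|now apply inv_le_ratio_pow|exact IH].
    + rewrite mu_1_above by lia. assert (0 < ratio b ^ k) by now apply pow_lt. lra.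
Qed.

Lemma decays_mu (b : nat) : (2 <= b)%nat -> forall r, decays (ratio b) (mu b r).
Proof.
  intros Hb. destruct (ratio_bounds b Hb) as [Q0 Q1].
  apply (digit_ind b (fun r => decays (ratio b) (mu b r))); [exact Hb| | | |].
  - exists 1. intros d. rewrite mu_0. destruct (Z.eqb_spec 0 d) as [<-|].
    + simpl. rewrite Rabs_R1. lra.
    + rewrite Rabs_R0. assert (0 < ratio b ^ Z.abs_nat d) by now apply pow_lt. lra.
  (* The constant is dictated by [d = 1], where [mu_1_le] gives the bound 1 although [|d| = 1]. *)
  - exists (/ ratio b). intros d.
    assert (HQ : 0 < / ratio b) by now apply Rinv_0_lt_compat.
    rewrite Rabs_right by (apply Rle_ge, mu_nonneg, Hb).
    destruct (Z_le_dec d 1) as [H|H].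
    + assert (L := mu_1_le b (Z.to_nat (1 - d)) Hb).
      replace (1 - Z.of_nat (Z.to_nat (1 - d)))%Z with d in L by lia.
      eapply Rle_trans; [exact L|].
      destruct (Z.eq_dec d 1) as [->|Hd].
      * simpl. rewrite Rmult_1_r, Rinv_l; lra.
      * replace (Z.to_nat (1 - d)) with (S (Z.abs_nat d)) by lia. simpl.
        apply Rmult_le_compat_r; [apply pow_le; lra|].
        apply Rmult_le_reg_l with (ratio b); [lra|]. rewrite Rinv_r; nra.
    + rewrite mu_1_above by lia. apply Rmult_le_pos; [lra|apply pow_le; lra].
  - intros r [K HK]. exists K. intros d. rewrite mu_mul by exact Hb. apply HK.
  - intros r c Hc H1 H2.
    destruct (decays_plus_scal (ratio b) (INR (b - c) / INR b) (INR c / INR b)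
                (fun d => mu b r (d + - Z.of_nat c))
                (fun d => mu b (S r) (d + (- Z.of_nat c + Z.of_nat b)))
                ltac:(apply decays_shift; [lra|exact H1]) ltac:(apply decays_shift; [lra|exact H2]))
      as [K HK].
    exists K. intros d. rewrite mu_mix by lia.
    replace (d - Z.of_nat c + Z.of_nat b)%Z with (d + (- Z.of_nat c + Z.of_nat b))%Z by lia.
    apply HK.
Qed.

Definition expect (b r : nat) (F : Z -> R) : R := zsum (fun d => F d * mu b r d).

Lemma zsummable_expect (b r : nat) (F : Z -> R) : (2 <= b)%nat -> tempered F ->
  zsummable (fun d => F d * mu b r d).
Proof.
  intros Hb HF. apply (zsummable_tempered_decays (ratio b)); auto using ratio_bounds, decays_mu.
Qed.

Lemma expect_ext (b r : nat) (F G : Z -> R) : (forall d, F d = G d) ->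
  expect b r F = expect b r G.
Proof. intros H. apply zsum_ext. intros d. now rewrite H. Qed.

Lemma expect_plus (b r : nat) (F G : Z -> R) : (2 <= b)%nat -> tempered F -> tempered G ->
  expect b r (fun d => F d + G d) = expect b r F + expect b r G.
Proof.
  intros Hb HF HG. unfold expect. rewrite <- zsum_plus by now apply zsummable_expect.
  apply zsum_ext. intros d. ring.
Qed.

Lemma expect_scal (b r : nat) (a : R) (F : Z -> R) :
  expect b r (fun d => a * F d) = a * expect b r F.
Proof. unfold expect. rewrite <- zsum_scal. apply zsum_ext. intros d. ring. Qed.

Lemma expect_le (b r : nat) (F G : Z -> R) : (2 <= b)%nat -> tempered F -> tempered G ->
  (forall d, F d <= G d) -> expect b r F <= expect b r G.
Proof.
  intros Hb HF HG H. apply zsum_le; try now apply zsummable_expect.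
  intros d. apply Rmult_le_compat_r; [now apply mu_nonneg|apply H].
Qed.

Lemma expect_shift (b r : nat) (c : Z) (F : Z -> R) : (2 <= b)%nat -> tempered F ->
  zsummable (fun d => F d * mu b r (d - c)) /\
  zsum (fun d => F d * mu b r (d - c)) = expect b r (fun d => F (d + c)%Z).
Proof.
  intros Hb HF. destruct (ratio_bounds b Hb) as [Q0 Q1].
  assert (H : zsummable (fun d => F d * mu b r (d - c))).
  { apply (zsummable_tempered_decays (ratio b)); [lra|exact HF|].
    apply (decays_shift (ratio b) (- c)); [lra|now apply decays_mu]. }
  split; [exact H|]. unfold expect.
  rewrite <- (zsum_shift c _ H).
  - apply zsum_ext. intros d. do 2 f_equal. lia.
  - apply zsummable_ext with (fun d => F (d + c)%Z * mu b r d).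
    + intros d. do 2 f_equal. lia.
    + now apply (zsummable_expect b r (fun d => F (d + c)%Z)), tempered_shift.
Qed.

(** The dual form of [mu_mix]: shifts of the measure become opposite shifts of the test function. *)
Lemma expect_mix (b r c : nat) (F : Z -> R) : (2 <= b)%nat -> (c < b)%nat -> tempered F ->
  expect b (b * r + c) F =
  INR (b - c) / INR b * expect b r (fun d => F (d + Z.of_nat c)%Z)
  + INR c / INR b * expect b (S r) (fun d => F (d + (Z.of_nat c - Z.of_nat b))%Z).
Proof.
  intros Hb Hc HF.
  destruct (expect_shift b r (Z.of_nat c) F Hb HF) as [S1 <-].
  destruct (expect_shift b (S r) (Z.of_nat c - Z.of_nat b) F Hb HF) as [S2 <-].
  rewrite <- !zsum_scal, <- zsum_plus by now apply zsummable_scal.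
  apply zsum_ext. intros d. rewrite mu_mix by assumption.
  replace (d - Z.of_nat c + Z.of_nat b)%Z with (d - (Z.of_nat c - Z.of_nat b))%Z by lia. ring.
Qed.

Lemma expect_0 (b : nat) (F : Z -> R) : expect b 0 F = F 0%Z.
Proof.
  unfold expect, zsum.
  assert (Z0 : forall u : nat -> R, (forall n, u n = 0) -> ex_series u /\ Series u = 0).
  { intros u Hu. assert (H := is_series_zero u Hu). split; [now exists 0|now apply is_series_unique]. }
  assert (H : forall d, d <> 0%Z -> F d * mu b 0 d = 0).
  { intros d Hd. rewrite mu_0. destruct (Z.eqb_spec 0 d); [lia|ring]. }
  destruct (Z0 (fun k => F (- Z.of_nat (S k))%Z * mu b 0 (- Z.of_nat (S k)))) as [_ ->].
  { intros n. apply H. lia. }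
  destruct (Z0 (fun k => F (Z.of_nat (S k)) * mu b 0 (Z.of_nat (S k)))) as [E1 E2].
  { intros n. apply H. lia. }
  rewrite Series_incr_1.
  - rewrite E2, mu_0. simpl. ring.
  - now apply (ex_series_incr_1 (fun k => F (Z.of_nat k) * mu b 0 (Z.of_nat k))).
Qed.

(** Since the carry leads from 0 back to 1, this is a fixed point equation with contraction factor
    [1 / b], from which mass, mean and variance at 1 can be solved. *)
Lemma expect_1_mix (b : nat) (F : Z -> R) : (2 <= b)%nat -> tempered F ->
  expect b 1 F = ratio b * F 1%Z + / INR b * expect b 1 (fun d => F (d + (1 - Z.of_nat b))%Z).
Proof.
  intros Hb HF. assert (H := expect_mix b 0 1 F Hb ltac:(lia) HF).
  replace (b * 0 + 1)%nat with 1%nat in H by lia. rewrite H, expect_0.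
  unfold ratio, Rdiv. simpl INR. simpl Z.of_nat. simpl Z.add. ring.
Qed.

(** * Second moments and blocks *)

Lemma tempered_const (k : R) : tempered (fun _ => k).
Proof. apply (tempered_bounded _ (Rabs k)). intros _. lra. Qed.

Lemma tempered_IZR : tempered IZR.
Proof.
  exists 1. intros d. rewrite Rmult_1_l. apply Rabs_le.
  assert (0 <= (IZR d - 1) ^ 2) by apply pow2_ge_0.
  assert (0 <= (IZR d + 1) ^ 2) by apply pow2_ge_0. nra.
Qed.

Lemma tempered_sqr : tempered (fun d => IZR d ^ 2).
Proof.
  exists 1. intros d. assert (0 <= IZR d ^ 2) by apply pow2_ge_0.
  rewrite Rabs_right; lra.
Qed.

Lemma tempered_plus (F G : Z -> R) : tempered F -> tempered G -> tempered (fun d => F d + G d).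
Proof.
  intros [K1 H1] [K2 H2]. exists (K1 + K2). intros d.
  eapply Rle_trans; [apply Rabs_triang|]. rewrite Rmult_plus_distr_r.
  now apply Rplus_le_compat.
Qed.

Lemma tempered_scal (a : R) (F : Z -> R) : tempered F -> tempered (fun d => a * F d).
Proof.
  intros [K HK]. exists (Rabs a * K). intros d. rewrite Rabs_mult, Rmult_assoc.
  apply Rmult_le_compat_l; [apply Rabs_pos|apply HK].
Qed.

Lemma INR_base (b : nat) : (2 <= b)%nat -> 2 <= INR b.
Proof. intros Hb. apply (le_INR 2) in Hb. simpl in Hb. lra. Qed.

Lemma expect_1 (b : nat) : (2 <= b)%nat -> forall r, expect b r (fun _ => 1) = 1.
Proof.
  intros Hb. assert (HB := INR_base b Hb).
  apply (digit_ind b (fun r => expect b r (fun _ => 1) = 1)); [exact Hb| | | |].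
  - apply expect_0.
  - assert (H := expect_1_mix b _ Hb (tempered_const 1)). unfold ratio in H.
    rewrite minus_INR in H by lia. simpl INR in H.
    set (T := expect b 1 (fun _ => 1)) in *.
    assert (E : T * (1 - / INR b) = 1 - / INR b).
    { replace (1 - / INR b) with ((INR b - 1) / INR b * 1) at 2 by (field; lra). lra. }
    assert (0 < 1 - / INR b).
    { assert (/ INR b <= / 2) by (apply Rinv_le_contravar; lra). lra. }
    nra.
  - intros r H. rewrite <- (Nat.add_0_r (b * r)), expect_mix by (lia || apply tempered_const).
    rewrite H, Nat.sub_0_r. simpl INR. field. lra.
  - intros r c Hc H1 H2. rewrite expect_mix by (lia || apply tempered_const).
    rewrite H1, H2, minus_INR by lia. field. lra.
Qed.

Lemma expect_const (b r : nat) (k : R) : (2 <= b)%nat -> expect b r (fun _ => k) = k.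
Proof.
  intros Hb. rewrite (expect_ext _ _ _ (fun _ => k * 1)) by (intros; ring).
  rewrite expect_scal, expect_1 by exact Hb. ring.
Qed.

Lemma expect_add_const (b r : nat) (c : R) (F : Z -> R) : (2 <= b)%nat -> tempered F ->
  expect b r (fun d => F d + c) = expect b r F + c.
Proof.
  intros Hb HF. rewrite expect_plus, expect_const; auto using tempered_const.
Qed.

Lemma expect_IZR_shift (b r : nat) (c : Z) : (2 <= b)%nat ->
  expect b r (fun d => IZR (d + c)) = expect b r IZR + IZR c.
Proof.
  intros Hb. rewrite <- expect_add_const by auto using tempered_IZR.
  apply expect_ext. intros d. apply plus_IZR.
Qed.

(** The shifts [c] and [c - b] with weights [(b - c) / b] and [c / b] average to 0, so the zero mean
    is inherited; at 1 the fixed point equation forces it. *)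
Lemma expect_IZR (b : nat) : (2 <= b)%nat -> forall r, expect b r IZR = 0.
Proof.
  intros Hb. assert (HB := INR_base b Hb).
  apply (digit_ind b (fun r => expect b r IZR = 0)); [exact Hb| | | |].
  - apply expect_0.
  - assert (H := expect_1_mix b _ Hb tempered_IZR). unfold ratio in H.
    rewrite minus_INR, expect_IZR_shift, minus_IZR, <- INR_IZR_INZ in H by lia. simpl INR in H.
    set (T := expect b 1 IZR) in *.
    assert (E : T * (1 - / INR b) = 0).
    { replace 0 with ((INR b - 1) / INR b * 1 + / INR b * (1 - INR b)) by (field; lra). lra. }
    assert (0 < 1 - / INR b).
    { assert (/ INR b <= / 2) by (apply Rinv_le_contravar; lra). lra. }
    nra.
  - intros r H. rewrite <- (Nat.add_0_r (b * r)), expect_mix by (lia || apply tempered_IZR).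
    rewrite expect_IZR_shift, H by exact Hb. simpl INR. simpl IZR. field. lra.
  - intros r c Hc H1 H2. rewrite expect_mix by (lia || apply tempered_IZR).
    rewrite !expect_IZR_shift, H1, H2, minus_IZR, <- !INR_IZR_INZ, minus_INR by lia. field. lra.
Qed.

Definition moment2 (b r : nat) : R := expect b r (fun d => IZR d ^ 2).

Lemma var_mu_moment2 (b r : nat) : (2 <= b)%nat -> var_mu b r = moment2 b r.
Proof.
  intros Hb. unfold var_mu.
  replace (mean_mu b r) with 0 by (symmetry; now apply expect_IZR).
  unfold moment2, expect. ring.
Qed.

Lemma moment2_nonneg (b r : nat) : (2 <= b)%nat -> 0 <= moment2 b r.
Proof.
  intros Hb. rewrite <- (expect_const b r 0 Hb).
  apply expect_le; auto using tempered_const, tempered_sqr. intros d. apply pow2_ge_0.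
Qed.

(** The cross term vanishes because the mean is 0. *)
Lemma moment2_shift (b r : nat) (c : Z) : (2 <= b)%nat ->
  expect b r (fun d => IZR (d + c) ^ 2) = moment2 b r + IZR c ^ 2.
Proof.
  intros Hb.
  rewrite (expect_ext _ _ _ (fun d => (IZR d ^ 2 + (2 * IZR c) * IZR d) + IZR c ^ 2))
    by (intros d; rewrite plus_IZR; ring).
  rewrite expect_add_const, expect_plus, expect_scal, expect_IZR
    by auto using tempered_plus, tempered_scal, tempered_sqr, tempered_IZR.
  unfold moment2. ring.
Qed.

(** The inhomogeneous term is the variance of the shift: [(b - c) / b * c ^ 2 + c / b * (b - c) ^ 2
    = c * (b - c)]. *)
Lemma moment2_mix (b r c : nat) : (2 <= b)%nat -> (c < b)%nat ->
  moment2 b (b * r + c) =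
  INR (b - c) / INR b * moment2 b r + INR c / INR b * moment2 b (S r) + INR c * INR (b - c).
Proof.
  intros Hb Hc. assert (HB := INR_base b Hb). unfold moment2 at 1.
  rewrite expect_mix by auto using tempered_sqr.
  rewrite !moment2_shift, minus_IZR, <- !INR_IZR_INZ, minus_INR by lia. field. lra.
Qed.

Lemma moment2_0 (b : nat) : moment2 b 0 = 0.
Proof. unfold moment2. rewrite expect_0. ring. Qed.

Lemma moment2_1 (b : nat) : (2 <= b)%nat -> moment2 b 1 = INR b.
Proof.
  intros Hb. assert (HB := INR_base b Hb).
  assert (H := moment2_mix b 0 1 Hb ltac:(lia)).
  replace (b * 0 + 1)%nat with 1%nat in H by lia.
  rewrite moment2_0, minus_INR in H by lia. simpl INR in H.
  set (T := moment2 b 1) in *.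
  assert (E : (T - INR b) * (1 - / INR b) = 0).
  { replace ((T - INR b) * (1 - / INR b))
      with (T - ((INR b - 1) / INR b * 0 + 1 / INR b * T + 1 * (INR b - 1))) by (field; lra). lra. }
  assert (0 < 1 - / INR b).
  { assert (/ INR b <= / 2) by (apply Rinv_le_contravar; lra). lra. }
  nra.
Qed.

(** * Growth of the second moment with the number of blocks *)

Definition slope (b r : nat) : R := moment2 b (S r) - moment2 b r.

(** The successor of [b * r + c] is [b * r + S c], or [b * S r] when [c = b - 1]; in both cases the
    moments of [r] and [S r] enter only through their difference, so the slope has a recursion of
    its own. *)
Lemma slope_mix (b r c : nat) : (2 <= b)%nat -> (c < b)%nat ->
  slope b (b * r + c) = slope b r / INR b + INR b - 1 - 2 * INR c.
Proof.
  intros Hb Hc. assert (HB := INR_base b Hb). unfold slope.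
  destruct (Nat.eq_dec (S c) b) as [E|E].
  - replace (S (b * r + c)) with (b * S r + 0)%nat by lia.
    rewrite !moment2_mix, Nat.sub_0_r by lia.
    replace (INR (b - c)) with 1 by (replace (b - c)%nat with 1%nat by lia; reflexivity).
    replace (INR c) with (INR b - 1) by (rewrite <- E, S_INR; ring).
    simpl INR. field. lra.
  - replace (S (b * r + c)) with (b * r + S c)%nat by lia.
    rewrite !moment2_mix, !minus_INR, S_INR by lia. field. lra.
Qed.

Lemma div_ind (b : nat) (P : nat -> Prop) : (2 <= b)%nat -> P 0%nat ->
  (forall r c, (c < b)%nat -> P r -> P (b * r + c)%nat) -> forall r, P r.
Proof.
  intros Hb P0 PS r. induction r as [r IH] using lt_wf_ind.
  destruct (Nat.eq_dec r 0) as [->|H]; [exact P0|].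
  rewrite (Nat.div_mod_eq r b). apply PS.
  - apply Nat.mod_upper_bound. lia.
  - apply IH, Nat.div_lt; lia.
Qed.

Lemma Rdiv_between (x B : R) : 0 < B -> - B <= x <= B -> -1 <= x / B <= 1.
Proof. intros HB Hx. split; [apply Rle_div_r|apply Rle_div_l]; lra. Qed.

(** The interval from [- b] to [b] is invariant: [slope / b] has absolute value at most 1, and
    [b - 1 - 2 * c] at most [b - 1]. *)
Lemma slope_bounds (b : nat) : (2 <= b)%nat -> forall r, - INR b <= slope b r <= INR b.
Proof.
  intros Hb. assert (HB := INR_base b Hb).
  apply (div_ind b (fun r => - INR b <= slope b r <= INR b)); [exact Hb| |].
  - unfold slope. rewrite moment2_0, moment2_1 by exact Hb. lra.
  - intros r c Hc IH. rewrite slope_mix by assumption.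
    apply Rdiv_between in IH; [|lra].
    assert (0 <= INR c) by apply pos_INR.
    assert (INR c + 1 <= INR b) by (rewrite <- S_INR; apply le_INR; lia). lra.
Qed.

(** The slopes [b] and [- b] are the fixed points of the recursion for the digits 0 and [b - 1];
    this is the product of the distances to them. It can become small only inside long runs of these
    digits. *)
Definition gap (b r : nat) : R := INR b ^ 2 - slope b r ^ 2.

Lemma gap_nonneg (b r : nat) : (2 <= b)%nat -> 0 <= gap b r.
Proof.
  intros Hb. assert (H := slope_bounds b Hb r). unfold gap.
  replace (INR b ^ 2 - slope b r ^ 2) with ((INR b - slope b r) * (INR b + slope b r)) by ring.
  apply Rmult_le_pos; lra.
Qed.

Definition energy (b r : nat) : R := moment2 b r + slope b r / 2 + slope b r ^ 2 / 4.

(* Completing the square makes the increment of the second moment independent of the digit. *)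
Lemma energy_mix (b r c : nat) : (2 <= b)%nat -> (c < b)%nat ->
  energy b (b * r + c) = energy b r + (INR b ^ 2 - 1) / (4 * INR b ^ 2) * gap b r.
Proof.
  intros Hb Hc. assert (HB := INR_base b Hb). unfold energy, gap.
  rewrite slope_mix, moment2_mix, minus_INR by lia.
  replace (moment2 b (S r)) with (moment2 b r + slope b r) by (unfold slope; ring).
  field. lra.
Qed.

(** The numbers [r / b ^ k] are the prefixes met when [r] is read from the top. The index starts at
    1 since [energy_mix] evaluates the gap before the new digit is appended. *)
Fixpoint gap_sum (b r L : nat) : R :=
  match L with
  | 0%nat => 0
  | S L => gap_sum b r L + gap b (r / b ^ S L)
  end.

Lemma div_pow_digit (b r k : nat) : (2 <= b)%nat ->
  (r / b ^ k = b * (r / b ^ S k) + digit b r k)%nat.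
Proof.
  intros Hb. unfold digit. rewrite Nat.pow_succ_r', (Nat.mul_comm b (b ^ k)), <- Nat.Div0.div_div.
  apply Nat.div_mod_eq.
Qed.

Lemma digit_lt (b r k : nat) : (2 <= b)%nat -> (digit b r k < b)%nat.
Proof. intros Hb. apply Nat.mod_upper_bound. lia. Qed.

Lemma energy_gap_sum (b r L : nat) : (2 <= b)%nat ->
  energy b r = energy b (r / b ^ L) + (INR b ^ 2 - 1) / (4 * INR b ^ 2) * gap_sum b r L.
Proof.
  intros Hb. induction L as [|L IH].
  - rewrite Nat.pow_0_r, Nat.div_1_r. simpl gap_sum. ring.
  - rewrite IH, (div_pow_digit b r L Hb), energy_mix by auto using digit_lt.
    cbn [gap_sum]. ring.
Qed.

Lemma slope_digit_bounds (b r c : nat) : (2 <= b)%nat -> (c < b)%nat ->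
  INR b - 2 - 2 * INR c <= slope b (b * r + c) <= INR b - 2 * INR c.
Proof.
  intros Hb Hc. assert (HB := INR_base b Hb). rewrite slope_mix by assumption.
  assert (H := slope_bounds b Hb r). apply Rdiv_between in H; lra.
Qed.

(** Such a last digit confines the slope to the interval from [2 - b] to [b - 2]. *)
Lemma gap_mid (b r c : nat) : (2 <= b)%nat -> (0 < c < b - 1)%nat -> 2 <= gap b (b * r + c).
Proof.
  intros Hb Hc. assert (H := slope_digit_bounds b r c Hb ltac:(lia)).
  assert (1 <= INR c) by (apply (le_INR 1); lia).
  assert (Hc2 : (c + 2 <= b)%nat) by lia.
  assert (INR c + 2 <= INR b) by (apply le_INR in Hc2; rewrite plus_INR in Hc2; simpl in Hc2; lra).
  unfold gap. nra.
Qed.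

(** The nonzero digit above leaves a slope of at most [b - 2], and one digit 0 divides its distance
    from the fixed point [b] only by [b]. The gap is then at least [2 / b * (2 * b - 2) >= 2]. *)
Lemma gap_zero (b r c : nat) : (2 <= b)%nat -> (0 < c < b)%nat ->
  2 <= gap b (b * (b * r + c) + 0).
Proof.
  intros Hb Hc. assert (HB := INR_base b Hb).
  assert (H := slope_digit_bounds b r c Hb ltac:(lia)).
  assert (1 <= INR c) by (apply (le_INR 1); lia).
  assert (H' := slope_bounds b Hb (b * r + c)).
  unfold gap. rewrite (slope_mix b (b * r + c) 0) by lia.
  simpl (INR 0). set (s := slope b (b * r + c)) in *.
  assert (E : s / INR b * INR b = s) by (field; lra).
  apply Rdiv_between in H'; [|lra]. set (x := s / INR b) in *.
  assert (2 <= (1 - x) * INR b) by lra.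
  replace (INR b ^ 2 - (x + INR b - 1 - 2 * 0) ^ 2) with ((1 - x) * (2 * INR b - 1 + x)) by ring.
  nra.
Qed.

(** Mirror image of [gap_zero], at the fixed point [- b]. *)
Lemma gap_max (b r c : nat) : (2 <= b)%nat -> (c < b - 1)%nat ->
  2 <= gap b (b * (b * r + c) + (b - 1)).
Proof.
  intros Hb Hc. assert (HB := INR_base b Hb).
  assert (H := slope_digit_bounds b r c Hb ltac:(lia)).
  assert (Hc2 : (c + 2 <= b)%nat) by lia.
  assert (INR c + 2 <= INR b) by (apply le_INR in Hc2; rewrite plus_INR in Hc2; simpl in Hc2; lra).
  assert (H' := slope_bounds b Hb (b * r + c)).
  unfold gap. rewrite (slope_mix b (b * r + c) (b - 1)), minus_INR by lia.
  simpl (INR 1). set (s := slope b (b * r + c)) in *.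
  assert (E : s / INR b * INR b = s) by (field; lra).
  apply Rdiv_between in H'; [|lra]. set (x := s / INR b) in *.
  assert (2 <= (1 + x) * INR b) by lra.
  replace (INR b ^ 2 - (x + INR b - 1 - 2 * (INR b - 1)) ^ 2)
    with ((1 + x) * (2 * INR b - 1 - x)) by ring.
  nra.
Qed.

(** Either one of the two digits lies strictly between 0 and [b - 1], and [gap_mid] applies to its
    prefix, or they are 0 and [b - 1] in some order, and the lower one is handled by [gap_zero] or
    [gap_max]. *)
Lemma block_start_gap (b r k : nat) : (2 <= b)%nat -> block_start b r (S k) = true ->
  2 <= gap b (r / b ^ k) + gap b (r / b ^ S k).
Proof.
  intros Hb H. unfold block_start in H. apply andb_prop in H. destruct H as [_ H].
  replace (S k - 1)%nat with k in H by lia. rewrite (div_pow_digit b r k Hb).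
  assert (Hc := digit_lt b r k Hb). assert (Hc' := digit_lt b r (S k) Hb).
  assert (G0 := gap_nonneg b (r / b ^ S k) Hb).
  assert (G1 := gap_nonneg b (b * (r / b ^ S k) + digit b r k) Hb).
  revert H G0 G1. rewrite (div_pow_digit b r (S k) Hb).
  set (c := digit b r k) in *. set (c' := digit b r (S k)) in *.
  set (p := (r / b ^ S (S k))%nat). intros H G0 G1.
  unfold dclass in H.
  destruct (Nat.eqb_spec c' 0) as [Z'|Z'], (Nat.eqb_spec c' (b - 1)) as [M'|M'],
    (Nat.eqb_spec c 0) as [Z|Z], (Nat.eqb_spec c (b - 1)) as [M|M]; try lia; simpl in H;
    try discriminate H;
    try (assert (X := gap_mid b p c' Hb ltac:(lia)); lra);
    try (assert (X := gap_mid b (b * p + c') c Hb ltac:(lia)); lra);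
    try (rewrite M in *; assert (X := gap_max b p c' Hb ltac:(lia)); lra);
    try (rewrite Z in *; assert (X := gap_zero b p c' Hb ltac:(lia)); lra).
Qed.

(** Summing [block_start_gap] over adjacent positions counts every interior gap twice and each end
    once, which yields the two boundary terms. *)
Lemma block_count_gap_sum (b r L : nat) : (2 <= b)%nat ->
  2 * INR (length (filter (block_start b r) (seq 1 L)))
  <= 2 * gap_sum b r L + gap b r - gap b (r / b ^ L).
Proof.
  intros Hb. induction L as [|L IH].
  - rewrite Nat.pow_0_r, Nat.div_1_r. simpl. lra.
  - rewrite seq_S, filter_app, length_app, plus_INR. cbn [gap_sum].
    assert (G0 := gap_nonneg b (r / b ^ L) Hb). assert (G1 := gap_nonneg b (r / b ^ S L) Hb).
    assert (H := block_start_gap b r L Hb).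
    change (1 + L)%nat with (S L). cbn [filter].
    destruct (block_start b r (S L)); simpl INR; [specialize (H eq_refl)|]; lra.
Qed.

(** The energy is within a bounded distance of the second moment and gains a multiple of [gap_sum].
    The subtracted 1 pays for the block at position 0, and [b ^ 2] for the boundary gap at [r]. *)
Lemma moment2_rho (b r : nat) : (2 <= b)%nat ->
  (INR b ^ 2 - 1) / (4 * INR b ^ 2) * (INR (rho b r) - 1 - INR b ^ 2) - INR b - INR b ^ 2
  <= moment2 b r.
Proof.
  intros Hb. assert (HB := INR_base b Hb).
  assert (HK : 0 < (INR b ^ 2 - 1) / (4 * INR b ^ 2)) by (apply Rdiv_lt_0_compat; nra).
  set (K := (INR b ^ 2 - 1) / (4 * INR b ^ 2)) in *.
  assert (E := energy_gap_sum b r r Hb). fold K in E.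
  assert (C := block_count_gap_sum b r r Hb).
  assert (G0 := gap_nonneg b (r / b ^ r) Hb).
  assert (G1 : gap b r <= INR b ^ 2) by (unfold gap; generalize (pow2_ge_0 (slope b r)); lra).
  assert (R1 : INR (rho b r) <= 1 + INR (length (filter (block_start b r) (seq 1 r)))).
  { unfold rho. change (seq 0 (S r)) with (0%nat :: seq 1 r). simpl filter.
    destruct (block_start b r 0); simpl length; rewrite ?S_INR; lra. }
  assert (GS : INR (rho b r) - 1 - INR b ^ 2 <= gap_sum b r r) by nra.
  (* Completing the square: [s / 2 + s ^ 2 / 4 = ((s + 1) ^ 2 - 1) / 4]. *)
  assert (E0 : - / 4 <= energy b (r / b ^ r)).
  { unfold energy. assert (M := moment2_nonneg b (r / b ^ r) Hb).
    assert (S2 := pow2_ge_0 (slope b (r / b ^ r) + 1)). lra. }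
  assert (E1 : energy b r <= moment2 b r + INR b / 2 + INR b ^ 2 / 4).
  { unfold energy. assert (S := slope_bounds b Hb r). unfold gap in G1.
    assert (slope b r ^ 2 <= INR b ^ 2) by (assert (G := gap_nonneg b r Hb); unfold gap in G; lra).
    lra. }
  apply Rmult_le_compat_l with (r := K) in GS; [|lra].
  nra.
Qed.

(** * Taylor expansion of solutions of the heat equation *)

Lemma between_Rabs (y z : R) : Rmin 0 y <= z <= Rmax 0 y -> Rabs z <= Rabs y.
Proof.
  unfold Rmin, Rmax. destruct (Rle_dec 0 y) as [H|H]; intros Hz.
  - rewrite !Rabs_right; lra.
  - rewrite !Rabs_left1; lra.
Qed.

(** One step of Taylor's formula. The factor [1 / (n + 1)] is given up, so that one constant [M]
    serves all orders. *)
Lemma MVT_pow_bound (f df : R -> R) (y M : R) (n : nat) : f 0 = 0 ->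
  (forall z, Rmin 0 y <= z <= Rmax 0 y -> is_derive f z (df z)) ->
  (forall z, Rmin 0 y <= z <= Rmax 0 y -> Rabs (df z) <= M * Rabs z ^ n) -> 0 <= M ->
  Rabs (f y) <= M * Rabs y ^ S n.
Proof.
  intros H0 Hd Hb HM. destruct (MVT_gen f 0 y df) as [z [Hz E]].
  - intros z Hz. apply Hd. lra.
  - intros z Hz. apply continuity_pt_filterlim, (ex_derive_continuous f).
    eexists. now apply Hd.
  - replace (f y) with (df z * y) by lra. rewrite Rabs_mult, <- tech_pow_Rmult.
    rewrite (Rmult_comm (Rabs y)), <- Rmult_assoc.
    apply Rmult_le_compat_r; [apply Rabs_pos|].
    eapply Rle_trans; [now apply Hb|]. apply Rmult_le_compat_l; [exact HM|].
    apply pow_incr. split; [apply Rabs_pos|now apply between_Rabs].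
Qed.

Section Heat.

Variables (g gx gxx gxxx gtt : R -> R -> R) (M : R).
Hypothesis HM : 0 <= M.
Hypothesis Dx : forall t x, 0 <= t -> is_derive (g t) x (gx t x).
Hypothesis Dxx : forall t x, 0 <= t -> is_derive (gx t) x (gxx t x).
Hypothesis Dxxx : forall t x, 0 <= t -> is_derive (gxx t) x (gxxx t x).
Hypothesis Dt : forall t x, 0 <= t -> is_derive (fun u => g u x) t (gxx t x / 2).
Hypothesis Dtt : forall t x, 0 <= t -> is_derive (fun u => gxx u x / 2) t (gtt t x).
Hypothesis Bx : forall t x, 0 <= t -> Rabs (gxxx t x) <= M.
Hypothesis Bt : forall t x, 0 <= t -> Rabs (gtt t x) <= M.

Lemma is_derive_shift (f : R -> R) (x z l : R) :
  is_derive f (x + z) l -> is_derive (fun u => f (x + u)) z l.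
Proof.
  intros H. replace l with (1 * l) by ring.
  apply (is_derive_comp f (fun u => x + u)); [exact H|].
  auto_derive; [exact I|ring].
Qed.

Lemma heat_taylor_x1 (t x y : R) : 0 <= t -> Rabs (gxx t (x + y) - gxx t x) <= M * Rabs y.
Proof.
  intros Ht. rewrite <- (pow_1 (Rabs y)).
  apply (MVT_pow_bound (fun z => gxx t (x + z) - gxx t x) (fun z => gxxx t (x + z))); [| | |exact HM].
  - rewrite Rplus_0_r. ring.
  - intros z _. replace (gxxx t (x + z)) with (gxxx t (x + z) - 0) by ring.
    apply @is_derive_minus; [apply is_derive_shift, Dxxx, Ht|apply @is_derive_const].
  - intros z _. simpl. rewrite Rmult_1_r. apply Bx, Ht.
Qed.

Lemma heat_taylor_x2 (t x y : R) : 0 <= t ->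
  Rabs (gx t (x + y) - gx t x - y * gxx t x) <= M * Rabs y ^ 2.
Proof.
  intros Ht.
  apply (MVT_pow_bound (fun z => gx t (x + z) - gx t x - z * gxx t x)
           (fun z => gxx t (x + z) - gxx t x)); [| | |exact HM].
  - rewrite Rplus_0_r. ring.
  - intros z _. apply @is_derive_minus.
    + replace (gxx t (x + z)) with (gxx t (x + z) - 0) by ring.
      apply @is_derive_minus; [apply is_derive_shift, Dxx, Ht|apply @is_derive_const].
    + auto_derive; [exact I|ring].
  - intros z _. rewrite pow_1. apply heat_taylor_x1, Ht.
Qed.

Lemma heat_taylor_x3 (t x y : R) : 0 <= t ->
  Rabs (g t (x + y) - g t x - y * gx t x - y ^ 2 / 2 * gxx t x) <= M * Rabs y ^ 3.
Proof.
  intros Ht.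
  apply (MVT_pow_bound (fun z => g t (x + z) - g t x - z * gx t x - z ^ 2 / 2 * gxx t x)
           (fun z => gx t (x + z) - gx t x - z * gxx t x)); [| | |exact HM].
  - rewrite Rplus_0_r. field.
  - intros z _. apply @is_derive_minus; [apply @is_derive_minus|].
    + replace (gx t (x + z)) with (gx t (x + z) - 0) by ring.
      apply @is_derive_minus; [apply is_derive_shift, Dx, Ht|apply @is_derive_const].
    + auto_derive; [exact I|ring].
    + auto_derive; [exact I|field].
  - intros z _. apply heat_taylor_x2, Ht.
Qed.

Lemma heat_taylor_t1 (t s x : R) : 0 <= t -> 0 <= t + s ->
  Rabs (gxx (t + s) x / 2 - gxx t x / 2) <= M * Rabs s.
Proof.
  intros Ht Hs. rewrite <- (pow_1 (Rabs s)).
  assert (P : forall z, Rmin 0 s <= z <= Rmax 0 s -> 0 <= t + z).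
  { unfold Rmin, Rmax. intros z. destruct (Rle_dec 0 s); lra. }
  apply (MVT_pow_bound (fun z => gxx (t + z) x / 2 - gxx t x / 2) (fun z => gtt (t + z) x));
    [| | |exact HM].
  - rewrite Rplus_0_r. ring.
  - intros z Hz. replace (gtt (t + z) x) with (gtt (t + z) x - 0) by ring.
    apply @is_derive_minus; [|apply @is_derive_const].
    apply (is_derive_shift (fun u => gxx u x / 2)), Dtt, P, Hz.
  - intros z Hz. simpl. rewrite Rmult_1_r. apply Bt, P, Hz.
Qed.

Lemma heat_taylor_t2 (t s x : R) : 0 <= t -> 0 <= t + s ->
  Rabs (g (t + s) x - g t x - s * (gxx t x / 2)) <= M * Rabs s ^ 2.
Proof.
  intros Ht Hs.
  assert (P : forall z, Rmin 0 s <= z <= Rmax 0 s -> 0 <= t + z).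
  { unfold Rmin, Rmax. intros z. destruct (Rle_dec 0 s); lra. }
  apply (MVT_pow_bound (fun z => g (t + z) x - g t x - z * (gxx t x / 2))
           (fun z => gxx (t + z) x / 2 - gxx t x / 2)); [| | |exact HM].
  - rewrite Rplus_0_r. ring.
  - intros z Hz. apply @is_derive_minus.
    + replace (gxx (t + z) x / 2) with (gxx (t + z) x / 2 - 0) by ring.
      apply @is_derive_minus; [|apply @is_derive_const].
      apply (is_derive_shift (fun u => g u x)), Dt, P, Hz.
    + auto_derive; [exact I|ring].
  - intros z Hz. rewrite pow_1. apply heat_taylor_t1; [exact Ht|apply P, Hz].
Qed.

(** The increment is split into a time step at [x + y] and a space step at [t]; moving [gxx] from
    [x + y] back to [x] yields the mixed term. For [s] of order [h ^ 2] and [y] of order [h] every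
    error is [O(h ^ 3)]. *)
Lemma heat_taylor (t s x y : R) : 0 <= t -> 0 <= t + s ->
  Rabs (g (t + s) (x + y) - g t x - y * gx t x - (s + y ^ 2) / 2 * gxx t x)
  <= M * (Rabs s ^ 2 + Rabs s * Rabs y + Rabs y ^ 3).
Proof.
  intros Ht Hs.
  replace (g (t + s) (x + y) - g t x - y * gx t x - (s + y ^ 2) / 2 * gxx t x)
    with ((g (t + s) (x + y) - g t (x + y) - s * (gxx t (x + y) / 2))
          + s / 2 * (gxx t (x + y) - gxx t x)
          + (g t (x + y) - g t x - y * gx t x - y ^ 2 / 2 * gxx t x)) by field.
  rewrite !Rmult_plus_distr_l.
  eapply Rle_trans; [apply Rabs_triang|]. apply Rplus_le_compat; [|now apply heat_taylor_x3].
  eapply Rle_trans; [apply Rabs_triang|]. apply Rplus_le_compat; [now apply heat_taylor_t2|].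
  rewrite Rabs_mult. assert (H := heat_taylor_x1 t x y Ht).
  replace (M * (Rabs s * Rabs y)) with (Rabs s * (M * Rabs y)) by ring.
  apply Rmult_le_compat; auto using Rabs_pos.
  unfold Rdiv. rewrite Rabs_mult, (Rabs_right (/ 2)) by lra. generalize (Rabs_pos s). lra.
Qed.

End Heat.

(** * The Gaussian solution and bounds for its derivatives *)

Definition heat (a e t x : R) : R := Phi ((a - x) * / sqrt (t + e)).

Lemma is_derive_gauss (y : R) : is_derive gauss y (- y * gauss y).
Proof.
  assert (0 < sqrt (2 * PI)) by (apply sqrt_lt_R0; generalize PI_RGT_0; lra).
  unfold gauss. auto_derive; [exact I|].
  change (y * (y * 1)) with (y ^ 2). unfold Rdiv. field. lra.
Qed.

Lemma is_derive_heat_arg_x (a e t x : R) :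
  is_derive (fun u => (a - u) * / sqrt (t + e)) x (- / sqrt (t + e)).
Proof. auto_derive; [exact I|ring]. Qed.

Lemma is_derive_inv_sqrt (e t : R) : 0 < t + e ->
  is_derive (fun u => / sqrt (u + e)) t (- (/ sqrt (t + e)) ^ 3 / 2).
Proof.
  intros H. assert (0 < sqrt (t + e)) by now apply sqrt_lt_R0.
  auto_derive; [split; [lra|split; [lra|exact I]]|]. field. lra.
Qed.

Lemma is_derive_gauss_comp (f : R -> R) (x l : R) : is_derive f x l ->
  is_derive (fun u => gauss (f u)) x (l * (- f x * gauss (f x))).
Proof. intros H. apply (is_derive_comp gauss f); [apply is_derive_gauss|exact H]. Qed.

(** From [exp (y ^ 2 / 4) >= 1 + y ^ 2 / 4], squared; degree 4 suffices for the cubic factors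
    below. *)
Lemma gauss_le (y : R) : gauss y * (1 + y ^ 2 / 4) ^ 2 <= 1.
Proof.
  assert (P := gauss_pos y).
  assert (H1 : gauss y <= exp (- y ^ 2 / 2)).
  { unfold gauss. assert (E := exp_pos (- y ^ 2 / 2)).
    assert (1 <= sqrt (2 * PI)).
    { rewrite <- sqrt_1. apply sqrt_le_1; generalize PI2_1; lra. }
    assert (/ sqrt (2 * PI) <= 1) by (rewrite <- Rinv_1; apply Rinv_le_contravar; lra).
    nra. }
  assert (H2 : exp (- y ^ 2 / 2) * (exp (y ^ 2 / 4) * exp (y ^ 2 / 4)) = 1).
  { rewrite <- !exp_plus, <- exp_0. f_equal. field. }
  assert (H3 := exp_ineq1_le (y ^ 2 / 4)).
  assert (H4 : 0 <= y ^ 2) by apply pow2_ge_0.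
  assert ((1 + y ^ 2 / 4) ^ 2 <= exp (y ^ 2 / 4) * exp (y ^ 2 / 4)).
  { replace ((1 + y ^ 2 / 4) ^ 2) with ((1 + y ^ 2 / 4) * (1 + y ^ 2 / 4)) by ring.
    apply Rmult_le_compat; lra. }
  assert (0 <= (1 + y ^ 2 / 4) ^ 2) by apply pow2_ge_0.
  eapply Rle_trans; [|right; exact H2]. apply Rmult_le_compat; lra.
Qed.

(** These are the profiles of the third space derivative and of the second time derivative of
    [heat]. *)
Lemma gauss_poly_bounds (y : R) :
  Rabs ((1 - y ^ 2) * gauss y) <= 4 /\ Rabs (y * (3 - y ^ 2) / 4 * gauss y) <= 4.
Proof.
  assert (P := gauss_pos y). assert (H := gauss_le y).
  assert (K : forall u, Rabs u <= 4 * (1 + y ^ 2 / 4) ^ 2 -> Rabs (u * gauss y) <= 4).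
  { intros u Hu. rewrite Rabs_mult, (Rabs_right (gauss y)) by lra. nra. }
  assert (Y2 : 0 <= y ^ 2) by apply pow2_ge_0.
  split; apply K, Rabs_le.
  - nra.
  - assert (0 <= y ^ 2 * (y - 1) ^ 2) by (apply Rmult_le_pos; apply pow2_ge_0).
    assert (0 <= y ^ 2 * (y + 1) ^ 2) by (apply Rmult_le_pos; apply pow2_ge_0).
    assert (0 <= (y - 1) ^ 2) by apply pow2_ge_0.
    assert (0 <= (y + 1) ^ 2) by apply pow2_ge_0. nra.
Qed.

(* [heat a e t x] is the probability that [x + sqrt (t + e) Z <= a] for a standard normal [Z],
   hence a solution of the heat equation [g_t = g_xx / 2]. *)
Lemma heat_expansion (a e : R) : 0 < e ->
  exists M (gx gxx : R -> R -> R), 0 <= M /\ forall t s x y, 0 <= t -> 0 <= t + s ->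
  Rabs (heat a e (t + s) (x + y) - heat a e t x - y * gx t x - (s + y ^ 2) / 2 * gxx t x)
  <= M * (Rabs s ^ 2 + Rabs s * Rabs y + Rabs y ^ 3).
Proof.
  intros He.
  (* [r] is an inverse standard deviation and [z] the standardised argument. The derivatives are
     powers of [r] times a polynomial in [z] times [gauss z], and [e > 0] bounds [r] by [R0]. *)
  set (r := fun t => / sqrt (t + e)). set (z := fun t x => (a - x) * r t).
  set (R0 := / sqrt e).
  assert (Hs : forall t, 0 <= t -> 0 < sqrt (t + e)) by (intros; apply sqrt_lt_R0; lra).
  assert (HR : 0 < R0) by (apply Rinv_0_lt_compat, sqrt_lt_R0, He).
  assert (Hr : forall t, 0 <= t -> 0 < r t <= R0).
  { intros t Ht. split; [now apply Rinv_0_lt_compat, Hs|].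
    apply Rinv_le_contravar; [now apply sqrt_lt_R0|apply sqrt_le_1; lra]. }
  assert (Hpow : forall t n, 0 <= t -> 0 <= r t ^ n <= R0 ^ n).
  { intros t n Ht. destruct (Hr t Ht). split; [apply pow_le|apply pow_incr]; lra. }
  assert (Dzx : forall t x, is_derive (z t) x (- r t)) by (intros; apply is_derive_heat_arg_x).
  assert (Dr : forall t, 0 <= t -> is_derive r t (- r t ^ 3 / 2))
    by (intros; apply is_derive_inv_sqrt; lra).
  assert (Dzt : forall t x, 0 <= t -> is_derive (fun u => z u x) t (- z t x * r t ^ 2 / 2)).
  { intros t x Ht. replace (- z t x * r t ^ 2 / 2) with ((a - x) * (- r t ^ 3 / 2))
      by (unfold z; field).
    apply (is_derive_scal r), Dr, Ht. }
  pose (gx := fun t x => - r t * gauss (z t x)).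
  pose (gxx := fun t x => - r t ^ 2 * (z t x * gauss (z t x))).
  pose (gxxx := fun t x => r t ^ 3 * ((1 - z t x ^ 2) * gauss (z t x))).
  (* By the heat equation this is a quarter of the fourth space derivative. *)
  pose (gtt := fun t x => r t ^ 4 * (z t x * (3 - z t x ^ 2) / 4 * gauss (z t x))).
  exists (4 * (R0 ^ 3 + R0 ^ 4)), gx, gxx.
  assert (HR3 : 0 < R0 ^ 3) by now apply pow_lt.
  assert (HR4 : 0 < R0 ^ 4) by now apply pow_lt.
  split; [lra|].
  intros t s x y. apply (heat_taylor (heat a e) gx gxx gxxx gtt); clear t s x y.
  - lra.
  - intros t x Ht. apply (is_derive_comp Phi (z t)); [apply is_derive_Phi|apply Dzx].
  - intros t x Ht. replace (gxx t x) with (- r t * (- r t * (- z t x * gauss (z t x))))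
      by (unfold gxx; ring).
    apply (is_derive_scal (fun x => gauss (z t x))), is_derive_gauss_comp, Dzx.
  - intros t x Ht.
    replace (gxxx t x) with (- r t ^ 2 *
      (plus (mult (- r t) (gauss (z t x))) (mult (z t x) (- r t * (- z t x * gauss (z t x))))))
      by (unfold gxxx, plus, mult; simpl; ring).
    apply (is_derive_scal (fun x => z t x * gauss (z t x))).
    apply (is_derive_mult (z t) (fun x => gauss (z t x)));
      [apply Dzx|apply is_derive_gauss_comp, Dzx|intros; apply Rmult_comm].
  - intros t x Ht. replace (gxx t x / 2) with ((- z t x * r t ^ 2 / 2) * gauss (z t x))
      by (unfold gxx; field).
    apply (is_derive_comp Phi (fun u => z u x)); [apply is_derive_Phi|now apply Dzt].
  - intros t x Ht.
    apply (is_derive_ext (fun u => - / 2 * (r u ^ 2 * (z u x * gauss (z u x))))).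
    { intros u. unfold gxx. simpl. field. }
    replace (gtt t x) with (- / 2 *
      plus (mult (INR 2 * (- r t ^ 3 / 2) * r t ^ 1) (z t x * gauss (z t x)))
        (mult (r t ^ 2) (plus (mult (- z t x * r t ^ 2 / 2) (gauss (z t x)))
          (mult (z t x) ((- z t x * r t ^ 2 / 2) * (- z t x * gauss (z t x)))))))
      by (unfold gtt, plus, mult; simpl; field).
    apply (is_derive_scal (fun u => r u ^ 2 * (z u x * gauss (z u x)))).
    apply (is_derive_mult (fun u => r u ^ 2) (fun u => z u x * gauss (z u x)));
      [apply (is_derive_pow r 2), Dr, Ht| |intros; apply Rmult_comm].
    apply (is_derive_mult (fun u => z u x) (fun u => gauss (z u x)));
      [now apply Dzt|apply (is_derive_gauss_comp (fun u => z u x)); now apply Dzt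
      |intros; apply Rmult_comm].
  - intros t x Ht. unfold gxxx. rewrite Rabs_mult.
    destruct (Hpow t 3%nat Ht). rewrite (Rabs_right (r t ^ 3)) by lra.
    destruct (gauss_poly_bounds (z t x)) as [H1 _].
    apply Rle_trans with (R0 ^ 3 * 4); [|lra]. apply Rmult_le_compat; auto using Rabs_pos.
  - intros t x Ht. unfold gtt. rewrite Rabs_mult.
    destruct (Hpow t 4%nat Ht). rewrite (Rabs_right (r t ^ 4)) by lra.
    destruct (gauss_poly_bounds (z t x)) as [_ H1].
    apply Rle_trans with (R0 ^ 4 * 4); [|lra]. apply Rmult_le_compat; auto using Rabs_pos.
Qed.

(** * Normal approximation *)

Lemma expect_mul (b r : nat) (F : Z -> R) : (2 <= b)%nat -> expect b (b * r) F = expect b r F.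
Proof. intros Hb. apply zsum_ext. intros d. now rewrite mu_mul. Qed.

(* The times [h^2 moment2] and displacements [h c], [h (c - b)] of one digit satisfy
   [E y = 0] and [E (s + y^2) = 0], so that only third order terms survive. *)
Lemma heat_digit_step (b : nat) (g gx gxx : R -> R -> R) (M h : R) :
  (2 <= b)%nat -> 0 <= M -> 0 < h <= 1 ->
  (forall t s x y, 0 <= t -> 0 <= t + s ->
    Rabs (g (t + s) (x + y) - g t x - y * gx t x - (s + y ^ 2) / 2 * gxx t x)
    <= M * (Rabs s ^ 2 + Rabs s * Rabs y + Rabs y ^ 3)) ->
  forall r c x, (0 < c < b)%nat ->
  Rabs (INR (b - c) / INR b * g (h ^ 2 * moment2 b r) (x + h * INR c)
        + INR c / INR b * g (h ^ 2 * moment2 b (S r)) (x + h * (INR c - INR b))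
        - g (h ^ 2 * moment2 b (b * r + c)) x)
  <= 8 * M * INR b ^ 4 * h ^ 3 * (INR c * INR (b - c)).
Proof.
  intros Hb HM Hh Hg r c x Hc. assert (HB := INR_base b Hb).
  assert (C1 : 1 <= INR c) by (apply (le_INR 1); lia).
  assert (C2 : 1 <= INR (b - c)) by (apply (le_INR 1); lia).
  assert (EM := moment2_mix b r c Hb ltac:(lia)).
  assert (HD := slope_bounds b Hb r). unfold slope in HD.
  assert (M0 := moment2_nonneg b r Hb). assert (M1 := moment2_nonneg b (S r) Hb).
  assert (M2 := moment2_nonneg b (b * r + c) Hb).
  rewrite minus_INR in * by lia.
  set (B := INR b) in *. set (k := INR c) in *.
  set (V0 := moment2 b r) in *. set (V1 := moment2 b (S r)) in *.
  set (V := moment2 b (b * r + c)) in *.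
  assert (Hh2 : 0 < h ^ 2) by nra.
  assert (P1 : 0 <= (B - k) / B <= 1) by (split; [apply Rdiv_le_0_compat|apply Rle_div_l]; lra).
  assert (P2 : 0 <= k / B <= 1) by (split; [apply Rdiv_le_0_compat|apply Rle_div_l]; lra).
  assert (P12 : (B - k) / B + k / B = 1) by (field; lra).
  (* Both branches are expanded around the same point, at the time [h ^ 2 * V] of the combined
     number. The bounds on [W - V] and [y] give [4 * B ^ 4 + 3 * B ^ 3 <= 8 * B ^ 4]. *)
  assert (Step : forall W y, 0 <= W -> Rabs (W - V) <= 2 * B ^ 2 -> Rabs y <= B ->
    Rabs (g (h ^ 2 * W) (x + h * y) - g (h ^ 2 * V) x - h * y * gx (h ^ 2 * V) x
          - h ^ 2 * ((W - V) + y ^ 2) / 2 * gxx (h ^ 2 * V) x) <= 8 * M * B ^ 4 * h ^ 3).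
  { intros W y HW HWV Hy.
    assert (H := Hg (h ^ 2 * V) (h ^ 2 * (W - V)) x (h * y)
                   ltac:(apply Rmult_le_pos; lra)
                   ltac:(replace (h ^ 2 * V + h ^ 2 * (W - V)) with (h ^ 2 * W) by ring;
                         apply Rmult_le_pos; lra)).
    replace (h ^ 2 * V + h ^ 2 * (W - V)) with (h ^ 2 * W) in H by ring.
    replace (h ^ 2 * (W - V) + (h * y) ^ 2) with (h ^ 2 * ((W - V) + y ^ 2)) in H by ring.
    eapply Rle_trans; [exact H|].
    rewrite !Rabs_mult, (Rabs_right (h ^ 2)), (Rabs_right h) by lra.
    set (u := Rabs (W - V)) in *. set (v := Rabs y) in *.
    assert (U0 : 0 <= u) by apply Rabs_pos. assert (V0' : 0 <= v) by apply Rabs_pos.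
    replace (8 * M * B ^ 4 * h ^ 3) with (M * (8 * B ^ 4 * h ^ 3)) by ring.
    apply Rmult_le_compat_l; [exact HM|].
    replace ((h ^ 2 * u) ^ 2 + h ^ 2 * u * (h * v) + (h * v) ^ 3)
      with (h ^ 3 * (h * u ^ 2 + u * v + v ^ 3)) by ring.
    rewrite (Rmult_comm _ (h ^ 3)). apply Rmult_le_compat_l; [apply pow_le; lra|].
    assert (u ^ 2 <= (2 * B ^ 2) ^ 2) by (apply pow_incr; lra).
    assert (v ^ 3 <= B ^ 3) by (apply pow_incr; lra).
    assert (u * v <= 2 * B ^ 2 * B) by (apply Rmult_le_compat; lra).
    assert (0 <= u ^ 2) by apply pow2_ge_0.
    assert (h * u ^ 2 <= u ^ 2) by nra.
    assert (0 < B ^ 3) by (apply pow_lt; lra).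
    assert (2 * B ^ 3 <= B ^ 4) by (replace (B ^ 4) with (B * B ^ 3) by ring; nra).
    replace ((2 * B ^ 2) ^ 2) with (4 * B ^ 4) in * by ring.
    replace (2 * B ^ 2 * B) with (2 * B ^ 3) in * by ring. lra. }
  assert (EV0 : V0 - V = - (k / B * (V1 - V0)) - k * (B - k)) by (rewrite EM; field; lra).
  assert (EV1 : V1 - V = (B - k) / B * (V1 - V0) - k * (B - k)) by (rewrite EM; field; lra).
  assert (Q0 : - B <= k / B * (V1 - V0) <= B) by nra.
  assert (Q1 : - B <= (B - k) / B * (V1 - V0) <= B) by nra.
  assert (Q2 : 0 <= k * (B - k) <= B * B) by nra.
  assert (S1 := Step V0 k M0 ltac:(apply Rabs_le; nra) ltac:(apply Rabs_le; lra)).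
  assert (S2 := Step V1 (k - B) M1 ltac:(apply Rabs_le; nra) ltac:(apply Rabs_le; lra)).
  match type of S1 with Rabs ?X <= _ => set (X1 := X) in S1 end.
  match type of S2 with Rabs ?X <= _ => set (X2 := X) in S2 end.
  set (E0 := 8 * M * B ^ 4 * h ^ 3) in *.
  assert (0 <= E0) by (generalize (Rabs_pos X1); lra).
  (* The weighted sums of [y] and of [W - V + y ^ 2] are 0, so the derivative terms cancel. *)
  match goal with |- Rabs ?X <= _ => replace X with ((B - k) / B * X1 + k / B * X2) end.
  2:{ unfold X1, X2. rewrite EV0, EV1. field. lra. }
  apply Rle_trans with E0; [|assert (1 <= k * (B - k)) by nra; nra].
  eapply Rle_trans; [apply Rabs_triang|].
  rewrite !Rabs_mult, (Rabs_right ((B - k) / B)), (Rabs_right (k / B)) by lra. nra.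
Qed.

(* The error obeys the same digit recursion as [moment2], whose inhomogeneous term
   [c (b - c)] is at least 1 unless the digit contributes no error at all. *)
Lemma expect_heat (b : nat) (g gx gxx : R -> R -> R) (M h : R) :
  (2 <= b)%nat -> 0 <= M -> 0 < h <= 1 ->
  (forall t s x y, 0 <= t -> 0 <= t + s ->
    Rabs (g (t + s) (x + y) - g t x - y * gx t x - (s + y ^ 2) / 2 * gxx t x)
    <= M * (Rabs s ^ 2 + Rabs s * Rabs y + Rabs y ^ 3)) ->
  (forall t x, Rabs (g t x) <= 1) ->
  forall r x, Rabs (expect b r (fun d => g 0 (x + h * IZR d)) - g (h ^ 2 * moment2 b r) x)
              <= 8 * M * INR b ^ 4 * h ^ 3 * moment2 b r.
Proof.
  intros Hb HM Hh Hg G1. assert (HB := INR_base b Hb).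
  assert (Step := heat_digit_step b g gx gxx M h Hb HM Hh Hg).
  set (E0 := 8 * M * INR b ^ 4 * h ^ 3) in *.
  assert (HE0 : 0 <= E0).
  { unfold E0. repeat apply Rmult_le_pos; try lra; apply pow_le; lra. }
  assert (HT : forall x, tempered (fun d => g 0 (x + h * IZR d))).
  { intros x. apply (tempered_bounded _ 1). intros d. apply G1. }
  assert (Shift : forall r x c, expect b r (fun d => g 0 (x + h * IZR (d + c)))
                 = expect b r (fun d => g 0 ((x + h * IZR c) + h * IZR d))).
  { intros r x c. apply expect_ext. intros d. f_equal. rewrite plus_IZR. ring. }
  set (err := fun r x => expect b r (fun d => g 0 (x + h * IZR d)) - g (h ^ 2 * moment2 b r) x).
  assert (Mix : forall r c x, (0 < c < b)%nat ->
    Rabs (err (b * r + c)%nat x) <= INR (b - c) / INR b * Rabs (err r (x + h * INR c))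
      + INR c / INR b * Rabs (err (S r) (x + h * (INR c - INR b))) + E0 * (INR c * INR (b - c))).
  { intros r c x Hc. specialize (Step r c x Hc). unfold err at 1.
    rewrite expect_mix by (lia || apply HT). rewrite !Shift.
    rewrite minus_IZR, <- !INR_IZR_INZ.
    match type of Step with Rabs ?X <= _ =>
      match goal with |- Rabs ?Y <= _ =>
        replace Y with (INR (b - c) / INR b * err r (x + h * INR c)
          + INR c / INR b * err (S r) (x + h * (INR c - INR b)) + X)
          by (unfold err; ring) end end.
    eapply Rle_trans; [apply Rabs_triang|]. apply Rplus_le_compat; [|exact Step].
    eapply Rle_trans; [apply Rabs_triang|]. rewrite !Rabs_mult.
    rewrite (Rabs_right (INR (b - c) / INR b)), (Rabs_right (INR c / INR b)); [lra| |];
      apply Rle_ge, Rdiv_le_0_compat; try apply pos_INR; lra. }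
  intros r. change (forall x, Rabs (err r x) <= E0 * moment2 b r). revert r.
  assert (Z0 : forall x, Rabs (err 0%nat x) <= E0 * moment2 b 0).
  { intros x. unfold err. rewrite expect_0, moment2_0, !Rmult_0_r, Rplus_0_r.
    unfold Rminus. rewrite Rplus_opp_r, Rabs_R0. lra. }
  apply (digit_ind b (fun r => forall x, Rabs (err r x) <= E0 * moment2 b r)).
  - exact Hb.
  - exact Z0.
  (* The recursion at 1 involves the error at 1 itself. Starting from the trivial bound 2 and
     iterating, the surplus shrinks by [1 / b] each time, while [E0 * b] is the fixed point of
     [T = T / b + E0 * (b - 1)]. *)
  - assert (It : forall n x, Rabs (err 1%nat x) <= E0 * moment2 b 1 + 2 * (/ INR b) ^ n).
    { rewrite moment2_1 by exact Hb. induction n as [|n IH]; intros x.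
      - assert (Rabs (err 1%nat x) <= 2).
        { unfold err. eapply Rle_trans; [apply Rabs_triang|]. rewrite Rabs_Ropp.
          apply (Rplus_le_compat _ 1 _ 1); [|apply G1].
          apply Rabs_le. split.
          - apply Rle_trans with (expect b 1 (fun _ => -1)); [rewrite expect_const by exact Hb; lra|].
            apply expect_le; auto using tempered_const.
            intros d. specialize (G1 0 (x + h * IZR d)). apply Rabs_le_between in G1. lra.
          - apply Rle_trans with (expect b 1 (fun _ => 1)); [|rewrite expect_const by exact Hb; lra].
            apply expect_le; auto using tempered_const.
            intros d. specialize (G1 0 (x + h * IZR d)). apply Rabs_le_between in G1. lra. }
        simpl. nra.
      - assert (H := Mix 0%nat 1%nat x ltac:(lia)).
        replace (b * 0 + 1)%nat with 1%nat in H by lia.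
        specialize (Z0 (x + h * INR 1)). rewrite moment2_0, Rmult_0_r in Z0.
        specialize (IH (x + h * (INR 1 - INR b))).
        rewrite minus_INR in H by lia. simpl INR in *.
        assert (Hi : 0 < / INR b) by (apply Rinv_0_lt_compat; lra).
        assert (Hq : 0 <= (INR b - 1) / INR b) by (apply Rdiv_le_0_compat; lra).
        replace (E0 * INR b + 2 * (/ INR b) ^ S n)
          with (1 / INR b * (E0 * INR b + 2 * (/ INR b) ^ n) + E0 * (1 * (INR b - 1)))
          by (simpl; field; lra).
        eapply Rle_trans; [exact H|]. apply Rplus_le_compat_r.
        assert ((INR b - 1) / INR b * Rabs (err 0%nat (x + h * 1)) <= 0) by nra.
        assert (1 / INR b * Rabs (err 1%nat (x + h * (1 - INR b)))
                <= 1 / INR b * (E0 * INR b + 2 * (/ INR b) ^ n)).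
        { apply Rmult_le_compat_l; [unfold Rdiv; lra|exact IH]. }
        lra. }
    intros x. apply le_epsilon. intros eps Heps.
    destruct (pow_lt_1_zero (/ INR b)) with (y := eps / 2) as [N HN].
    + assert (/ INR b <= / 2) by (apply Rinv_le_contravar; lra).
      assert (0 < / INR b) by (apply Rinv_0_lt_compat; lra). rewrite Rabs_right; lra.
    + lra.
    + specialize (HN N (le_n N)). specialize (It N x).
      apply Rabs_lt_between in HN. lra.
  - intros r IH x. unfold err. rewrite expect_mul by exact Hb.
    replace (moment2 b (b * r)) with (moment2 b r) by (symmetry; now apply expect_mul).
    apply IH.
  - intros r c Hc H1 H2 x. eapply Rle_trans; [now apply Mix|].
    rewrite moment2_mix by lia.
    specialize (H1 (x + h * INR c)). specialize (H2 (x + h * (INR c - INR b))).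
    assert (W1 : 0 <= INR (b - c) / INR b) by (apply Rdiv_le_0_compat; [apply pos_INR|lra]).
    assert (W2 : 0 <= INR c / INR b) by (apply Rdiv_le_0_compat; [apply pos_INR|lra]).
    apply Rmult_le_compat_l with (r := INR (b - c) / INR b) in H1; [|exact W1].
    apply Rmult_le_compat_l with (r := INR c / INR b) in H2; [|exact W2]. lra.
Qed.

(** * From smooth test functions to distribution functions *)

Lemma continuous_Phi (x : R) : continuous Phi x.
Proof. apply (ex_derive_continuous Phi). eexists. apply is_derive_Phi. Qed.

Definition below (s x : R) (d : Z) : R := if Rle_dec (IZR d / s) x then 1 else 0.

Lemma tempered_below (s x : R) : tempered (below s x).
Proof.
  apply (tempered_bounded _ 1). intros d. unfold below.
  destruct (Rle_dec _ _); rewrite ?Rabs_R1, ?Rabs_R0; lra.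
Qed.

Lemma cdf_tilde_expect (b r : nat) (x : R) :
  cdf_tilde b r x = expect b r (below (Defs.sigma b r) x).
Proof.
  apply zsum_ext. intros d. unfold below. destruct (Rle_dec _ _); ring.
Qed.

Lemma sqrt_0_pow4 (n : R) : 0 < n -> sqrt (0 + n ^ 4) = n ^ 2.
Proof.
  intros Hn. replace (0 + n ^ 4) with (n ^ 2 * n ^ 2) by ring.
  apply sqrt_square, pow2_ge_0.
Qed.

(** At time 0 the smoothing has standard deviation [n ^ 2] while the threshold is moved by [n].
    Points counted by [below] are thus at least [1 / n] deviations inside, and only a Gaussian tail
    is lost; [heat_le_below] is the mirror image. *)
Lemma below_le_heat (s x n : R) (d : Z) : 0 < s -> 0 < n ->
  below s x d <= heat (x + n) (n ^ 4) 0 (0 + / s * IZR d) + (1 - Phi (/ n)).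
Proof.
  intros Hs Hn. unfold below, heat. rewrite sqrt_0_pow4 by exact Hn.
  assert (P := Phi_bounds (/ n)).
  assert (Q := Phi_bounds ((x + n - (0 + / s * IZR d)) * / n ^ 2)).
  destruct (Rle_dec (IZR d / s) x) as [H|H]; [|lra].
  assert (Phi (/ n) <= Phi ((x + n - (0 + / s * IZR d)) * / n ^ 2)); [|lra].
  apply Phi_incr. replace (/ n) with (n * / n ^ 2) by (field; lra).
  apply Rmult_le_compat_r.
  - apply Rlt_le, Rinv_0_lt_compat. nra.
  - unfold Rdiv in H. lra.
Qed.

Lemma heat_le_below (s x n : R) (d : Z) : 0 < s -> 0 < n ->
  heat (x - n) (n ^ 4) 0 (0 + / s * IZR d) - Phi (- / n) <= below s x d.
Proof.
  intros Hs Hn. unfold below, heat. rewrite sqrt_0_pow4 by exact Hn.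
  assert (P := Phi_bounds (- / n)).
  assert (Q := Phi_bounds ((x - n - (0 + / s * IZR d)) * / n ^ 2)).
  destruct (Rle_dec (IZR d / s) x) as [H|H]; [lra|].
  assert (Phi ((x - n - (0 + / s * IZR d)) * / n ^ 2) <= Phi (- / n)); [|lra].
  apply Phi_incr. replace (- / n) with (- n * / n ^ 2) by (field; lra).
  apply Rmult_le_compat_r.
  - apply Rlt_le, Rinv_0_lt_compat. nra.
  - unfold Rdiv in H. lra.
Qed.

(** With [h = 1 / sigma] the final time [h ^ 2 * moment2] is 1 and the error is of order
    [h ^ 3 * moment2 = 1 / sigma]; [1 <= moment2 b r] ensures [h <= 1]. The constant depends on [b],
    [a] and [e] but not on [r]. *)
Lemma expect_heat_normalized (b : nat) (a e : R) : (2 <= b)%nat -> 0 < e ->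
  exists C, 0 <= C /\ forall r, 1 <= moment2 b r ->
  Rabs (expect b r (fun d => heat a e 0 (0 + / Defs.sigma b r * IZR d)) - heat a e 1 0)
  <= C / Defs.sigma b r.
Proof.
  intros Hb He. assert (HB := INR_base b Hb).
  destruct (heat_expansion a e He) as (M & gx & gxx & HM & Hg).
  exists (8 * M * INR b ^ 4). split.
  { repeat apply Rmult_le_pos; try lra. }
  intros r Hr. unfold Defs.sigma. rewrite var_mu_moment2 by exact Hb.
  set (s := sqrt (moment2 b r)).
  assert (Hs : 1 <= s) by (rewrite <- sqrt_1; apply sqrt_le_1; lra).
  assert (Hss : s * s = moment2 b r) by (apply sqrt_sqrt; lra).
  assert (Hh : 0 < / s <= 1).
  { split; [apply Rinv_0_lt_compat; lra|]. rewrite <- Rinv_1. apply Rinv_le_contravar; lra. }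
  assert (G1 : forall t x, Rabs (heat a e t x) <= 1).
  { intros t x. unfold heat. apply Rabs_le.
    assert (P := Phi_bounds ((a - x) * / sqrt (t + e))). lra. }
  assert (H := expect_heat b (heat a e) gx gxx M (/ s) Hb HM Hh Hg G1 r 0).
  rewrite <- Hss in H.
  replace ((/ s) ^ 2 * (s * s)) with 1 in H by (field; lra).
  replace (8 * M * INR b ^ 4 * (/ s) ^ 3 * (s * s)) with (8 * M * INR b ^ 4 / s) in H
    by (field; lra).
  exact H.
Qed.

Lemma heat_1_near (x k eps : R) : 0 < eps ->
  exists del, 0 < del /\ forall n, 0 < n < del ->
  Rabs (heat (x + k * n) (n ^ 4) 1 0 - Phi x) < eps.
Proof.
  intros Heps.
  assert (Hc : continuous (fun n => Phi ((x + k * n - 0) * / sqrt (1 + n ^ 4))) 0).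
  { apply (continuous_comp (fun n => (x + k * n - 0) * / sqrt (1 + n ^ 4)) Phi);
      [|apply continuous_Phi].
    apply (ex_derive_continuous (fun n => (x + k * n - 0) * / sqrt (1 + n ^ 4))).
    auto_derive. replace (1 + 0 * (0 * (0 * (0 * 1)))) with 1 by ring. rewrite sqrt_1. lra. }
  destruct (proj1 (filterlim_locally _ _) Hc (mkposreal eps Heps)) as [del Hdel].
  exists del. split; [apply cond_pos|]. intros n Hn.
  assert (HB : ball 0 del n).
  { change (Rabs (n - 0) < del). rewrite Rminus_0_r, Rabs_right; lra. }
  specialize (Hdel n HB). change (Rabs (Phi ((x + k * n - 0) * / sqrt (1 + n ^ 4))
    - Phi ((x + k * 0 - 0) * / sqrt (1 + 0 ^ 4))) < eps) in Hdel.
  replace ((x + k * 0 - 0) * / sqrt (1 + 0 ^ 4)) with x in Hdel; [exact Hdel|].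
  replace (1 + 0 ^ 4) with 1 by ring. rewrite sqrt_1. field.
Qed.

Lemma Phi_inv_tails (eps : R) : 0 < eps -> exists del, 0 < del /\ forall n, 0 < n < del ->
  1 - eps < Phi (/ n) /\ Phi (- / n) < eps.
Proof.
  intros Heps.
  destruct (proj2 (is_lim_spec _ _ _) is_lim_Phi_p (mkposreal eps Heps)) as [A HA].
  destruct (proj2 (is_lim_spec _ _ _) is_lim_Phi_m (mkposreal eps Heps)) as [A' HA'].
  simpl in HA, HA'. set (K := 1 + Rabs A + Rabs A').
  assert (PA := Rabs_pos A). assert (PA' := Rabs_pos A').
  exists (/ K). split; [apply Rinv_0_lt_compat; unfold K; lra|]. intros n Hn.
  assert (H : K < / n).
  { rewrite <- (Rinv_inv K). apply Rinv_lt_contravar; [|lra].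
    apply Rmult_lt_0_compat; [lra|]. apply Rinv_0_lt_compat. unfold K. lra. }
  assert (LA := Rle_abs A). assert (LA' := Rle_abs (- A')). rewrite Rabs_Ropp in LA'.
  unfold K in H. split.
  - specialize (HA (/ n) ltac:(lra)). apply Rabs_lt_between in HA. lra.
  - specialize (HA' (- / n) ltac:(lra)). apply Rabs_lt_between in HA'. lra.
Qed.

Theorem theorem2 (b : nat) (Hb : (2 <= b)%nat) (rs : nat -> nat)
  (Hr : forall n, (1 <= rs n)%nat)
  (Hrho : forall M : nat, exists N : nat, forall n, (N <= n)%nat -> (M <= rho b (rs n))%nat) :
  conv_dist_std_normal (fun n => cdf_tilde b (rs n)).
Proof.
  assert (HB := INR_base b Hb).
  assert (Hbig : forall A, exists N, forall n, (N <= n)%nat -> A <= moment2 b (rs n)).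
  { intros A.
    assert (HK : 0 < (INR b ^ 2 - 1) / (4 * INR b ^ 2)) by (apply Rdiv_lt_0_compat; nra).
    (* The threshold comes from solving the bound of [moment2_rho] for [rho]. *)
    destruct (nfloor_ex (Rmax 0 ((A + INR b + INR b ^ 2) / ((INR b ^ 2 - 1) / (4 * INR b ^ 2))
                                 + 1 + INR b ^ 2)) (Rmax_l _ _)) as [m [_ Hm]].
    destruct (Hrho (m + 1)%nat) as [N HN]. exists N. intros n Hn. specialize (HN n Hn).
    assert (H := moment2_rho b (rs n) Hb). eapply Rle_trans; [|exact H].
    apply le_INR in HN. rewrite plus_INR in HN. simpl (INR 1) in HN.
    set (K := (INR b ^ 2 - 1) / (4 * INR b ^ 2)) in *.
    assert (Hx := Rmax_r 0 ((A + INR b + INR b ^ 2) / K + 1 + INR b ^ 2)).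
    assert (Hle : (A + INR b + INR b ^ 2) / K <= INR (rho b (rs n)) - 1 - INR b ^ 2) by lra.
    apply Rle_div_l in Hle; [|exact HK]. lra. }
  intros x. apply is_lim_seq_spec. intros eps. assert (Heps := cond_pos eps).
  destruct (Phi_inv_tails (eps / 4) ltac:(lra)) as [d0 [D0 T0]].
  destruct (heat_1_near x 1 (eps / 4) ltac:(lra)) as [d1 [D1 T1]].
  destruct (heat_1_near x (-1) (eps / 4) ltac:(lra)) as [d2 [D2 T2]].
  (* The smoothing scale is fixed before the index of the sequence, because the constants [C1] and
     [C2] depend on it. *)
  set (n := Rmin d0 (Rmin d1 d2) / 2).
  assert (Hn : 0 < n /\ n < d0 /\ n < d1 /\ n < d2).
  { unfold n, Rmin. repeat destruct (Rle_dec _ _); lra. }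
  destruct Hn as (N0 & N1 & N2 & N3).
  specialize (T0 n (conj N0 N1)). specialize (T1 n (conj N0 N2)). specialize (T2 n (conj N0 N3)).
  assert (Hn4 : 0 < n ^ 4) by now apply pow_lt.
  replace (x + 1 * n) with (x + n) in T1 by ring. replace (x + -1 * n) with (x - n) in T2 by ring.
  destruct (expect_heat_normalized b (x + n) (n ^ 4) Hb Hn4) as [C1 [P1 H1]].
  destruct (expect_heat_normalized b (x - n) (n ^ 4) Hb Hn4) as [C2 [P2 H2]].
  (* Once [sigma] reaches [Q], each approximation error is below [eps / 4]; with the tail and the
     continuity error the total stays below [3 * eps / 4]. *)
  set (Q := 1 + 4 * (C1 + C2) / eps).
  assert (HQ : 1 <= Q).
  { unfold Q. assert (0 <= 4 * (C1 + C2) / eps) by (apply Rdiv_le_0_compat; lra). lra. }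
  destruct (Hbig (Q * Q)) as [N HN]. exists N. intros m Hm. specialize (HN m Hm).
  set (r := rs m) in *.
  assert (Hmom : 1 <= moment2 b r) by nra.
  specialize (H1 r Hmom). specialize (H2 r Hmom).
  rewrite cdf_tilde_expect.
  assert (Hs : Q <= Defs.sigma b r).
  { unfold Defs.sigma. rewrite var_mu_moment2 by exact Hb.
    rewrite <- (sqrt_square Q) by lra. apply sqrt_le_1; nra. }
  set (s := Defs.sigma b r) in *.
  assert (Small : forall C, 0 <= C <= C1 + C2 -> C / s < eps / 4).
  { intros C HC. apply Rlt_div_l; [lra|]. apply Rlt_le_trans with (eps / 4 * Q).
    - unfold Q. replace (eps / 4 * (1 + 4 * (C1 + C2) / eps)) with (eps / 4 + (C1 + C2))
        by (field; lra). lra.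
    - apply Rmult_le_compat_l; lra. }
  assert (S1 := Small C1 ltac:(lra)). assert (S2 := Small C2 ltac:(lra)).
  assert (HT : forall a, tempered (fun d => heat a (n ^ 4) 0 (0 + / s * IZR d))).
  { intros a. apply (tempered_bounded _ 1). intros d. unfold heat. apply Rabs_le.
    match goal with |- context [Phi ?y] => assert (P := Phi_bounds y) end. lra. }
  assert (U : expect b r (below s x)
    <= expect b r (fun d => heat (x + n) (n ^ 4) 0 (0 + / s * IZR d)) + (1 - Phi (/ n))).
  { rewrite <- expect_add_const by auto.
    apply expect_le; auto using tempered_below, tempered_plus, tempered_const.
    intros d. apply below_le_heat; lra. }
  assert (L : expect b r (fun d => heat (x - n) (n ^ 4) 0 (0 + / s * IZR d)) + - Phi (- / n)
    <= expect b r (below s x)).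
  { rewrite <- expect_add_const by auto.
    apply expect_le; auto using tempered_below, tempered_plus, tempered_const.
    intros d. apply heat_le_below; lra. }
  apply Rabs_le_between in H1, H2. apply Rabs_lt_between in T1, T2.
  apply Rabs_lt_between. lra.
Qed.
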